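(* For $m\in\mathbb{Z}\setminus\{0\}$, set $$X_m=\{BS(m,n) : n\in\mathbb{Z}\setminus\{0\} \text{ is relatively prime to } m\}\subset\mathcal{G}_2,\qquad Z_m^\times=\{\overline{BS}(m,\xi) : \xi\in\mathbb{Z}_m^\times\}\subset\mathcal{G}_2 ,$$ where, by convention, $Z_{\pm 1}^\times$ is empty. For all $m\in\mathbb{Z}\setminus\{0\}$, the boundary of $X_m$ in $\mathcal{G}_2$ (i.e. its set of accumulation points) is $Z_m^\times$. It is homeomorphic to the set of invertible $m$-adic integers.
   Context: A marked group on $k$ generators is a pair $(G,S)$ with $S=(s_1,\dots,s_k)\in G^k$ generating $G$, considered up to isomorphisms respecting the markings. $\mathcal{G}_k$ is the set of marked groups on $k$ generators with the ultrametric $d((G_1,S_1),(G_2,S_2))=e^{-\lambda}$ for distinct marked groups, where $\lambda$ is the word length of a shortest element of the free group $\mathbb{F}_k$ that is trivial in one group and not in the other. For $m,n\in\mathbb{Z}\setminus\{0\}$, $BS(m,n)=\langle a,b\mid ab^ma^{-1}=b^n\rangle$, marked by $(a,b)$. The ring of $m$-adic integers is $\mathbb{Z}_m=\varprojlim_h \mathbb{Z}/m^h\mathbb{Z}$ with the projective limit topology (it is the zero ring if $|m|=1$); $\mathbb{Z}_m^\times$ is its set of invertible elements. For $\xi\in\mathbb{Z}_m$, $\overline{BS}(m,\xi)=\lim_{n\to\infty}BS(m,\xi_n)$ in $\mathcal{G}_2$, marked by $(a,b)$, where $(\xi_n)_n$ is any sequence of non-zero rational integers with $|\xi_n|\to\infty$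 and $\xi_n\to\xi$ in $\mathbb{Z}_m$ (it is known that this limit exists and does not depend on the choice of $(\xi_n)_n$).
   Formalization: The convention that Z_{±1}^× is empty is dropped: it makes the claim false for m = ±1, where the infinite set X_{±1} has an accumulation point in the compact space G_2. For m = ±1, Z_m^× is instead the single point given by the one unit of the zero ring. *)

(* Defs.v *)
From HB Require Import structures.
From mathcomp Require Import all_boot all_order all_algebra.
From mathcomp Require Import all_classical all_reals all_analysis.

Set Implicit Arguments.
Unset Strict Implicit.
Unset Printing Implicit Defensive.

Import Order.TTheory GRing.Theory Num.Theory.

Local Open Scope classical_set_scope.
Local Open Scope group_scope.

Definition homeomorphic (T U : topologicalType) : Prop :=
  exists (f : T -> U) (g : U -> T),
    [/\ cancel f g, cancel g f, continuous f & continuous g].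

Definition expgz (G : groupType) (x : G) (z : int) : G :=
  match z with Posz n => x ^+ n | Negz n => x ^- n.+1 end.

Section FreeGroup.
Variable k : nat.

(* The free group on k generators is realized as the group of reduced words.
   The letter (i, false) is the i-th generator and (i, true) is its inverse. *)
Definition letter : Type := ('I_k * bool)%type.
Definition inv_letter (l : letter) : letter := (l.1, ~~ l.2).

Definition reduced (w : seq letter) : bool :=
  sorted (fun l l' => l' != inv_letter l) w.

Definition push (l : letter) (w : seq letter) : seq letter :=
  if w is l' :: w' then if l' == inv_letter l then w' else l :: w else [:: l].

Lemma inv_letterK : involutive inv_letter.
Proof. by case=> i b; rewrite /inv_letter /= negbK. Qed.

Lemma reduced_push l w : reduced w -> reduced (push l w).
Proof.
case: w => [|l' w] //=; case: eqP => [_|/eqP ne] wr /=.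
  exact: path_sorted wr.
by rewrite ne.
Qed.

Lemma pushK l w : reduced w -> push l (push (inv_letter l) w) = w.
Proof.
case: w => [|l' w] /=; first by rewrite eqxx.
rewrite inv_letterK; case: eqP => [->|ne] wr; last by rewrite /= eqxx.
by case: w wr => [|l'' w] //= /andP[/negPf -> _].
Qed.

Definition act (u v : seq letter) : seq letter := foldr push v u.

Lemma reduced_act u v : reduced v -> reduced (act u v).
Proof. by move=> vr; elim: u => //= l u; apply: reduced_push. Qed.

Lemma act_push l u w : reduced w -> act (push l u) w = push l (act u w).
Proof.
case: u => [|l' u] // wr; rewrite {1}/push; case: eqP => [->|//].
exact: (esym (pushK l (reduced_act u wr))).
Qed.

Lemma actA u v w : reduced w -> act (act u v) w = act u (act v w).
Proof. by move=> wr; elim: u => //= l u IHu; rewrite act_push ?IHu. Qed.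

Lemma act0 u : reduced u -> act u [::] = u.
Proof.
elim: u => //= l u IHu ur; rewrite IHu; last exact: path_sorted ur.
by case: u ur {IHu} => //= l' u /andP[/negPf -> _].
Qed.

Definition inv_word (u : seq letter) : seq letter := rev (map inv_letter u).

Lemma reduced_inv_word u : reduced u -> reduced (inv_word u).
Proof.
rewrite /reduced /inv_word rev_sorted sorted_map.
apply: sub_sorted => l l' /=.
by rewrite inv_letterK eq_sym; apply: contraNN => /eqP ->.
Qed.

Lemma act_cat u v w : act (u ++ v) w = act u (act v w).
Proof. exact: foldr_cat. Qed.

Lemma act_inv_word u v : reduced v -> act (inv_word u) (act u v) = v.
Proof.
elim: u v => //= l u IHu v vr.
rewrite /inv_word /= rev_cons -cats1 act_cat /=.
have := pushK (inv_letter l) (reduced_act u vr).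
by rewrite inv_letterK => ->; apply: IHu.
Qed.

Record free_group : predArgType :=
  FreeElt { word_of :> seq letter; word_reduced : reduced word_of }.

HB.instance Definition _ := [isSub for word_of].
HB.instance Definition _ := [Choice of free_group by <:].

Definition free_one : free_group := @FreeElt [::] isT.
Definition free_inv (x : free_group) : free_group :=
  FreeElt (reduced_inv_word (word_reduced x)).
Definition free_mul (x y : free_group) : free_group :=
  FreeElt (reduced_act x (word_reduced y)).

Lemma free_mulA : associative free_mul.
Proof. by move=> x y z; apply: val_inj; rewrite /= actA ?word_reduced. Qed.
Lemma free_mul1 : left_id free_one free_mul.
Proof. by move=> x; apply: val_inj. Qed.
Lemma free_mulr1 : right_id free_one free_mul.
Proof. by move=> x; apply: val_inj; rewrite /= act0 ?word_reduced. Qed.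
Lemma free_mulV : left_inverse free_one free_inv free_mul.
Proof.
move=> x; apply: val_inj => /=.
by rewrite -{2}(act0 (word_reduced x)) act_inv_word.
Qed.
Lemma free_mulrV : right_inverse free_one free_inv free_mul.
Proof.
move=> x; rewrite -{1}[x](_ : free_inv (free_inv x) = x) ?free_mulV//.
apply: val_inj; rewrite /= /inv_word map_rev revK -map_comp.
by rewrite (eq_map (g := id)) ?map_id// => l /=; rewrite inv_letterK.
Qed.

HB.instance Definition _ := isGroup.Build free_group
  free_mulA free_mul1 free_mulr1 free_mulV free_mulrV.

Definition free_gen (i : 'I_k) : free_group := @FreeElt [:: (i, false)] isT.

(* The image of w under the morphism from the free group mapping the i-th
   generator to s i. *)
Definition free_eval (G : groupType) (s : 'I_k -> G) (w : free_group) : G :=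
  \prod_(l <- word_of w) (if l.2 then (s l.1)^-1 else s l.1).

End FreeGroup.

Section QuotientGroup.
Variables (G : groupType) (R : set G).

Inductive normal_closure : G -> Prop :=
| nc_incl x : R x -> normal_closure x
| nc_one : normal_closure 1
| nc_mul x y : normal_closure x -> normal_closure y -> normal_closure (x * y)
| nc_inv x : normal_closure x -> normal_closure x^-1
| nc_conj x y : normal_closure x -> normal_closure (x ^ y).

Definition nc_rel (x y : G) : bool := `[< normal_closure (x^-1 * y) >].

Lemma nc_rel_refl : reflexive nc_rel.
Proof. by move=> x; apply/asboolP; rewrite mulVg; apply: nc_one. Qed.
Lemma nc_rel_sym : symmetric nc_rel.
Proof.
suff h x y : nc_rel x y -> nc_rel y x by move=> x y; apply/idP/idP; apply: h.
by move=> /asboolP/nc_inv; rewrite invgM invgK => ?; apply/asboolP.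
Qed.
Lemma nc_rel_trans : transitive nc_rel.
Proof.
move=> y x z /asboolP xy /asboolP yz; apply/asboolP.
by have := nc_mul xy yz; rewrite mulgA mulgK.
Qed.

Canonical nc_equiv := EquivRel nc_rel nc_rel_refl nc_rel_sym nc_rel_trans.

Local Open Scope quotient_scope.

Definition quotient_group : Type := {eq_quot nc_equiv}.
HB.instance Definition _ := Choice.on quotient_group.
HB.instance Definition _ := EqQuotient.on quotient_group.

Definition quo_proj (x : G) : quotient_group := \pi_quotient_group x.
Definition quo_mul (x y : quotient_group) := quo_proj (repr x * repr y).
Definition quo_inv (x : quotient_group) := quo_proj (repr x)^-1.

Lemma quo_projP x y : quo_proj x = quo_proj y <-> normal_closure (x^-1 * y).
Proof.
split=> [/eqmodP/asboolP//|h]; apply/eqmodP; exact/asboolP.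
Qed.

Lemma quo_reprK x : quo_proj (repr x) = x.
Proof. exact: reprK. Qed.

Lemma repr_quo_proj x : normal_closure (x^-1 * repr (quo_proj x)).
Proof. by apply/quo_projP; rewrite quo_reprK. Qed.

Lemma quo_projM x y : quo_mul (quo_proj x) (quo_proj y) = quo_proj (x * y).
Proof.
apply: esym; rewrite /quo_mul; apply/quo_projP.
have hx := repr_quo_proj x; have hy := repr_quo_proj y.
have := nc_mul (nc_conj y hx) hy; rewrite /conjg invgM.
by rewrite -!mulgA mulVKg.
Qed.

Lemma quo_projV x : quo_inv (quo_proj x) = quo_proj x^-1.
Proof.
rewrite /quo_inv; apply/quo_projP; rewrite invgK.
have := nc_conj (x^-1) (repr_quo_proj x).
by rewrite /conjg invgK -!mulgA mulVKg.
Qed.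

Lemma quo_mulA : associative quo_mul.
Proof.
move=> x y z; rewrite -[x]quo_reprK -[y]quo_reprK -[z]quo_reprK.
by rewrite !quo_projM mulgA.
Qed.
Lemma quo_mul1 : left_id (quo_proj 1) quo_mul.
Proof. by move=> x; rewrite -[x]quo_reprK quo_projM mul1g. Qed.
Lemma quo_mulr1 : right_id (quo_proj 1) quo_mul.
Proof. by move=> x; rewrite -[x]quo_reprK quo_projM mulg1. Qed.
Lemma quo_mulV : left_inverse (quo_proj 1) quo_inv quo_mul.
Proof. by move=> x; rewrite -[x]quo_reprK quo_projV quo_projM mulVg. Qed.
Lemma quo_mulrV : right_inverse (quo_proj 1) quo_inv quo_mul.
Proof. by move=> x; rewrite -[x]quo_reprK quo_projV quo_projM mulgV. Qed.

HB.instance Definition _ := isGroup.Build quotient_group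
  quo_mulA quo_mul1 quo_mulr1 quo_mulV quo_mulrV.

End QuotientGroup.

Definition generates (G : groupType) (k : nat) (s : 'I_k -> G) : Prop :=
  forall H : {pred G}, group_closed H -> (forall i, s i \in H) ->
  forall x, x \in H.

Record marked_group (k : nat) := MarkedGroup {
  mg_group : groupType;
  mg_gen : 'I_k -> mg_group;
  mg_generates : generates mg_gen }.

Definition marked_iso (k : nat) (M N : marked_group k) : Prop :=
  exists f : mg_group M -> mg_group N,
    [/\ bijective f, {morph f : x y / x * y} &
        forall i, f (mg_gen M i) = mg_gen N i].

Section FreeEval.
Variables (k : nat) (G : groupType) (s : 'I_k -> G).

Let ev (l : letter k) : G := if l.2 then (s l.1)^-1 else s l.1.

Let ev_inv l : ev (inv_letter l) = (ev l)^-1.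
Proof. by case: l => i [] /=; rewrite /ev /= ?invgK. Qed.

Let ev_push l w :
  \prod_(a <- push l w) ev a = ev l * \prod_(a <- w) ev a.
Proof.
case: w => [|l' w] /=; first by rewrite !(big_cons, big_nil).
case: eqP => [->|_]; last by rewrite !big_cons.
by rewrite big_cons ev_inv mulVKg.
Qed.

Lemma free_evalM x y : free_eval s (x * y) = free_eval s x * free_eval s y.
Proof.
rewrite /free_eval [word_of (x * y)]/=; elim: (word_of x) => [|l u IHu] /=.
  by rewrite big_nil mul1g.
by rewrite [LHS]ev_push IHu big_cons mulgA.
Qed.

Lemma free_eval1 : free_eval s 1 = 1.
Proof. exact: big_nil. Qed.

Lemma free_evalV x : free_eval s x^-1 = (free_eval s x)^-1.
Proof.
by apply: (mulIg (free_eval s x)); rewrite -free_evalM !mulVg free_eval1.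
Qed.

Lemma free_eval_gen i : free_eval s (free_gen i) = s i.
Proof. by rewrite /free_eval big_seq1. Qed.

Lemma free_eval_surj : generates s -> forall x, exists w, free_eval s w = x.
Proof.
move=> gs x; pose P y := exists w, free_eval s w = y.
suff : x \in [pred y | `[< P y >]] by move=> /asboolP.
apply: gs => [|i]; last first.
  by apply/asboolP; exists (free_gen i); apply: free_eval_gen.
split=> [|_ _ /asboolP[u <-] /asboolP[v <-]]; apply/asboolP.
  by exists 1; apply: free_eval1.
by exists (u * v^-1); rewrite free_evalM free_evalV.
Qed.

End FreeEval.

Section MarkedSpace.
Variable k : nat.
Implicit Types M N : marked_group k.

Definition trivial_in M (w : free_group k) : Prop :=
  free_eval (@mg_gen k M) w = 1.

Lemma marked_iso_of_trivial M N :
  (forall w, trivial_in M w <-> trivial_in N w) -> marked_iso M N.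
Proof.
rewrite /trivial_in => MN.
have eqMN v w : free_eval (@mg_gen k M) v = free_eval (@mg_gen k M) w <->
                free_eval (@mg_gen k N) v = free_eval (@mg_gen k N) w.
  have h (G : groupType) (s : 'I_k -> G) :
      free_eval s v = free_eval s w <-> free_eval s (v^-1 * w) = 1.
    rewrite free_evalM free_evalV; split=> [->|h]; first exact: mulVg.
    by rewrite -[RHS](mulVKg (free_eval s v)) h mulg1.
  by rewrite !h; apply: MN.
have /choice[rM rMP] := free_eval_surj (@mg_generates k M).
have /choice[rN rNP] := free_eval_surj (@mg_generates k N).
exists (fun x => free_eval (@mg_gen k N) (rM x)); split.
- exists (fun y => free_eval (@mg_gen k M) (rN y)) => [x|y].
    by rewrite -[RHS]rMP; apply/eqMN; rewrite rNP.
  by rewrite -[RHS]rNP; apply/eqMN; rewrite rMP.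
- by move=> x y; rewrite -free_evalM; apply/eqMN; rewrite free_evalM !rMP.
- move=> i; rewrite -[RHS]free_eval_gen; apply/eqMN.
  by rewrite rMP free_eval_gen.
Qed.

Lemma marked_iso_trivial M N :
  marked_iso M N -> forall w, trivial_in M w <-> trivial_in N w.
Proof.
move=> [f [fbij fM fs]] w; rewrite /trivial_in.
have f1 : f 1 = 1 by apply: (mulgI (f 1)); rewrite -fM !mulg1.
have fV x : f x^-1 = (f x)^-1.
  by apply: (mulIg (f x)); rewrite -fM !mulVg.
have -> : free_eval (@mg_gen k N) w = f (free_eval (@mg_gen k M) w).
  rewrite /free_eval; elim: (word_of w) => [|l u IHu].
    by rewrite !big_nil f1.
  rewrite !big_cons fM IHu; congr (_ * _).
  by case: l => i [] /=; rewrite ?fV fs.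
by split=> [->|]; rewrite -?f1//; apply: (bij_inj fbij).
Qed.

End MarkedSpace.

(* The set of marked groups on k generators up to marked isomorphism.  The
   quotient of marked_group k by marked_iso would live in too large a universe
   to carry a topology, so an isomorphism class is encoded by the set of the
   elements of the free group that are trivial in its members, which determines
   the class: see marked_classP and marked_class_surj below.
   The parameter R only fixes the field in which the distance takes its
   values. *)
Record marked_space (R : realType) (k : nat) := MarkedClass {
  class_trivial : set (free_group k);
  class_trivialP : exists M : marked_group k, class_trivial = trivial_in M }.

Section MarkedDistance.
Variables (R : realType) (k : nat).
Local Notation Gk := (marked_space R k).

HB.instance Definition _ := gen_eqMixin Gk.
HB.instance Definition _ := gen_choiceMixin Gk.

Definition marked_class (M : marked_group k) : Gk :=
  MarkedClass R (ex_intro _ M erefl).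

Implicit Types x y z : Gk.

Lemma marked_space_ext x y :
  (forall w, class_trivial x w <-> class_trivial y w) -> x = y.
Proof.
case: x y => [A hA] [B hB] /= AB.
have eAB : A = B by apply/funext => w; apply/propext.
by rewrite -eAB in hB *; congr MarkedClass; apply: Prop_irrelevance.
Qed.

Lemma marked_classP M N :
  marked_class M = marked_class N <-> marked_iso M N.
Proof.
split=> [[MN]|MN]; first by apply: marked_iso_of_trivial => w; rewrite MN.
by apply: marked_space_ext => w; apply: marked_iso_trivial.
Qed.

Lemma marked_class_surj x : exists M, marked_class M = x.
Proof.
have [M xM] := class_trivialP x; exists M.
by apply: marked_space_ext => w; rewrite xM.
Qed.

Definition separating_lengths x y : set nat :=
  [set n | exists2 w : free_group k,
     ~ (class_trivial x w <-> class_trivial y w) & n = size (word_of w)].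

Definition shortest_separating x y : nat :=
  get [set n | separating_lengths x y n /\
               forall p, separating_lengths x y p -> (n <= p)%N].

Definition marked_dist x y : R :=
  if x == y then 0%R else expR (- (shortest_separating x y)%:R)%R.

Lemma shortest_separatingP x y : x <> y ->
  separating_lengths x y (shortest_separating x y) /\
  forall p, separating_lengths x y p -> (shortest_separating x y <= p)%N.
Proof.
move=> xy; rewrite /shortest_separating; set S := [set n | _].
suff : exists n, S n by move/getPex.
have ex : exists n, `[< separating_lengths x y n >].
  apply: contrapT => /forallNP h; apply: xy.
  apply: marked_space_ext => w.
  apply: contrapT => xyw; case: (h (size (word_of w))).
  by apply/asboolP; exists w.
exists (ex_minn ex); case: ex_minnP => n /asboolP nP nmin; split=> // p pP.
by apply: nmin; apply/asboolP.
Qed.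

Lemma separating_lengthsC x y n :
  separating_lengths x y n -> separating_lengths y x n.
Proof. by case=> w xyw ->; exists w => // h; apply: xyw; split=> /h. Qed.

Lemma marked_distxx x : marked_dist x x = 0%R.
Proof. by rewrite /marked_dist eqxx. Qed.

Lemma marked_dist_eq0 x y : marked_dist x y = 0%R -> x = y.
Proof.
by rewrite /marked_dist; case: eqP => // _ /eqP; rewrite gt_eqF// expR_gt0.
Qed.

Lemma marked_dist_sym x y : marked_dist x y = marked_dist y x.
Proof.
rewrite /marked_dist eq_sym /shortest_separating.
have -> // : separating_lengths x y = separating_lengths y x.
by apply/seteqP; split=> n; apply: separating_lengthsC.
Qed.

Lemma marked_dist_ultra y x z :
  (marked_dist x z <= Num.max (marked_dist x y) (marked_dist y z))%R.
Proof.
have d_ge0 a b : (0 <= marked_dist a b)%R.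
  by rewrite /marked_dist; case: ifP => // _; apply: expR_ge0.
have [->|/eqP xz] := eqVneq x z; first by rewrite marked_distxx le_max d_ge0.
have [[w xzw wE] _] := shortest_separatingP xz.
have key a b : ~ (class_trivial a w <-> class_trivial b w) ->
    (marked_dist x z <= marked_dist a b)%R.
  move=> abw; have /eqP ab : a <> b by move=> ab; apply: abw; rewrite ab.
  rewrite /marked_dist (negPf ab) (introF eqP xz) ler_expR lerN2 ler_nat wE.
  have [_] := shortest_separatingP (elimN eqP ab).
  by apply; exists w.
rewrite le_max.
have [xyw|xyw] := pselect (class_trivial x w <-> class_trivial y w); last first.
  by rewrite (key x y).
by rewrite (key y z) ?orbT// => yzw; apply: xzw; rewrite xyw.
Qed.

Lemma marked_dist_triangle y x z :
  (marked_dist x z <= marked_dist x y + marked_dist y z)%R.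
Proof.
have d_ge0 a b : (0 <= marked_dist a b)%R.
  by rewrite /marked_dist; case: ifP => // _; apply: expR_ge0.
apply: le_trans (marked_dist_ultra y x z) _.
by rewrite ge_max lerDl lerDr !d_ge0.
Qed.

HB.instance Definition _ := isMetric.Build R Gk
  marked_distxx marked_dist_eq0 marked_dist_sym marked_dist_triangle.

End MarkedDistance.

Section Presentation.
Variables (k : nat) (R : set (free_group k)).

Lemma free_eval_free_gen (w : free_group k) : free_eval (@free_gen k) w = w.
Proof.
apply: val_inj; rewrite /free_eval /=; case: w => u /=.
elim: u => [|l u IHu] ur; first by rewrite big_nil.
have evM (x y : free_group k) : word_of (x * y) = act x y by [].
rewrite big_cons evM IHu; last exact: path_sorted ur.
have -> : word_of (if l.2 then (free_gen l.1)^-1 else free_gen l.1) = [:: l].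
  by case: l {ur} => i [].
by case: u ur {IHu} => //= l' u /andP[/negPf -> _].
Qed.

Lemma presented_generates :
  generates (fun i : 'I_k => quo_proj R (free_gen i)).
Proof.
move=> H Hgrp HS x; rewrite -[x]quo_reprK -[repr x]free_eval_free_gen.
have HM := group_closedM Hgrp; have HV := group_closedV Hgrp.
rewrite /free_eval; elim: (word_of (repr x)) => [|l u IHu].
  by rewrite big_nil; case: Hgrp.
rewrite big_cons -quo_projM; apply: HM => //.
by case: l => i [] //=; rewrite -quo_projV; apply: HV.
Qed.

Definition presented : marked_group k := MarkedGroup presented_generates.

End Presentation.

Definition BS_relator (m n : int) : free_group 2 :=
  let a := free_gen (ord0 : 'I_2) in let b := free_gen (ord_max : 'I_2) in
  a * expgz b m * a^-1 * (expgz b n)^-1.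

Definition BS (R : realType) (m n : int) : marked_space R 2 :=
  marked_class R (presented [set BS_relator m n]).

(* Z / n Z for n > 0.  Unlike 'Z_n, this is the zero ring when n = 1. *)
Definition zmod (n : nat) : Type := 'I_n.-1.+1.

Section ZmodRing.
Variable n : nat.
HB.instance Definition _ := Finite.on (zmod n).
HB.instance Definition _ := GRing.Zmodule.on (zmod n).
HB.instance Definition _ := GRing.Zmodule_isComPzRing.Build (zmod n)
  (@Zp_mulA n.-1.+1) (@Zp_mulC n.-1.+1) (@Zp_mul1z n.-1) (@Zp_mul_addl n.-1.+1).
End ZmodRing.

Local Open Scope ring_scope.

Section Padic.
Variable m : int.
Local Notation lvl h := (zmod (`|m| ^ h)%N).

Definition compatible (x : forall h, lvl h) : Prop :=
  forall h, inZp (x h.+1) = x h.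

(* The projective limit of the rings Z / m ^ h Z, with the topology of the
   subspace of the product of these rings, each of them being discrete. *)
Definition padic : Type := set_type
  (compatible : set (prod_topology (fun h => discrete_topology (lvl h)))).

HB.instance Definition _ := Topological.on padic.

Definition padic_lvl (x : padic) (h : nat) : lvl h := set_val x h.
Definition Padic (x : forall h, lvl h) (hx : compatible x) : padic :=
  SigSub (mem_set hx).

Lemma padic_lvlP (x : padic) : compatible (padic_lvl x).
Proof. exact: set_mem (valP x). Qed.

Lemma padic_eq (x y : padic) :
  (forall h, padic_lvl x h = padic_lvl y h) -> x = y.
Proof.
move=> xy; apply: val_inj; apply: functional_extensionality_dep => h.
exact: xy.
Qed.

Lemma dvd_lvl h : ((`|m| ^ h)%N.-1.+1 %| (`|m| ^ h.+1)%N.-1.+1)%N.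
Proof.
have [->|m0] := posnP `|m|%N; last first.
  by rewrite !prednK ?expn_gt0 ?m0// dvdn_exp2l.
by case: h => [|h]; [exact: dvd1n | rewrite !exp0n].
Qed.

Lemma compatible0 : compatible (fun h => 0).
Proof. by move=> h; apply: val_inj; rewrite /= mod0n. Qed.
Lemma compatible1 : compatible (fun h => 1).
Proof. by move=> h; apply: val_inj; rewrite /= (modn_dvdm _ (dvd_lvl h)). Qed.
Lemma compatibleD x y :
  compatible x -> compatible y -> compatible (fun h => x h + y h).
Proof.
move=> hx hy h; rewrite -[x h]hx -[y h]hy; apply: val_inj => /=.
by rewrite modnDm (modn_dvdm _ (dvd_lvl h)).
Qed.
Lemma compatibleN x : compatible x -> compatible (fun h => - x h).
Proof.
move=> hx h; apply/eqP; rewrite -addr_eq0 -[x h]hx; apply/eqP/val_inj => /=.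
rewrite modnDm -(modn_dvdm _ (dvd_lvl h)) modnDml.
by rewrite subnK ?modnn ?mod0n// ltnW.
Qed.
Lemma compatibleM x y :
  compatible x -> compatible y -> compatible (fun h => x h * y h).
Proof.
move=> hx hy h; rewrite -[x h]hx -[y h]hy; apply: val_inj => /=.
by rewrite modnMm (modn_dvdm _ (dvd_lvl h)).
Qed.

Definition padic0 : padic := Padic compatible0.
Definition padic1 : padic := Padic compatible1.
Definition padicN (x : padic) : padic := Padic (compatibleN (padic_lvlP x)).
Definition padicD (x y : padic) : padic :=
  Padic (compatibleD (padic_lvlP x) (padic_lvlP y)).
Definition padicM (x y : padic) : padic :=
  Padic (compatibleM (padic_lvlP x) (padic_lvlP y)).

Lemma padicDA : associative padicD.
Proof. by move=> x y z; apply: padic_eq => h; apply: addrA. Qed.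
Lemma padicDC : commutative padicD.
Proof. by move=> x y; apply: padic_eq => h; apply: addrC. Qed.
Lemma padicD0 : left_id padic0 padicD.
Proof. by move=> x; apply: padic_eq => h; apply: add0r. Qed.
Lemma padicDN : left_inverse padic0 padicN padicD.
Proof. by move=> x; apply: padic_eq => h; apply: addNr. Qed.
Lemma padicMA : associative padicM.
Proof. by move=> x y z; apply: padic_eq => h; apply: mulrA. Qed.
Lemma padicMC : commutative padicM.
Proof. by move=> x y; apply: padic_eq => h; apply: mulrC. Qed.
Lemma padicM1 : left_id padic1 padicM.
Proof. by move=> x; apply: padic_eq => h; apply: mul1r. Qed.
Lemma padicMD : left_distributive padicM padicD.
Proof. by move=> x y z; apply: padic_eq => h; apply: mulrDl. Qed.

HB.instance Definition _ := GRing.isZmodule.Build padic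
  padicDA padicDC padicD0 padicDN.
HB.instance Definition _ := GRing.Zmodule_isComPzRing.Build padic
  padicMA padicMC padicM1 padicMD.

(* GRing.unit is not available, since padic m is the zero ring for |m| = 1. *)
Definition padic_units : set padic := [set x | exists y, x * y = 1].

End Padic.

Section Limits.
Variables (R : realType) (m : int).

Definition admissible (xi : padic m) (u : nat -> int) : Prop :=
  [/\ forall n, u n != 0,
      `|u n|%N @[n --> \oo] --> \oo &
      ((u n)%:~R : padic m) @[n --> \oo] --> xi].

(* The default value of xget is irrelevant when m != 0. *)
Definition BSbar (xi : padic m) : marked_space R 2 :=
  xget (BS R m 1) [set x | forall u, admissible xi u ->
                             BS R m (u n) @[n --> \oo] --> x].

Definition BS_coprime : set (marked_space R 2) :=
  [set BS R m n | n in [set n : int | n != 0 /\ coprimez n m]].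

(* No exception is made for |m| = 1: 0 is then the only element of padic m and
   is a unit, and BSbar_units is the singleton of the limit of the BS(m, n) for
   |n| going to infinity. *)
Definition BSbar_units : set (marked_space R 2) :=
  [set BSbar xi | xi in @padic_units m].

End Limits.

Arguments padic_units : clear implicits.
Arguments BS_coprime : clear implicits.
Arguments BSbar_units : clear implicits.

(* Main.v *)
(* BS(m,n) acts on the normal forms of this HNN extension, and a word is trivial
   exactly when it fixes the empty normal form (Britton's lemma).  While a fixed
   word is applied, the exponents of b are values P(n/m) of polynomials P with
   integer coefficients; whether m divides P(n/m) only depends on n modulo a
   power of m, and, for |n| large, n divides P(n/m) if and only if P(0) = 0.
   So the words of bounded length that are trivial in BS(m,n) only depend on n
   modulo some m^N once |n| >= N, which makes xi |-> BSbar(m,xi) well defined and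
   continuous.

   Conversely, let n be prime to m and pick successively integers c_i such that
   every term of x_0 = m, x_(i+1) = n (x_i/m) + c_i is a multiple of m.  If
   another n' satisfies the first h of these divisibilities, then n = n' modulo
   m^h.  They are tested by words of bounded length, since in BS(m,n) the
   elements a b^x a^-1 and b commute if and only if m divides x.  Hence units xi
   depend continuously on BSbar(m,xi), and when BS(m,n_k) converges with |n_k|
   going to infinity and n_k prime to m, the sequence n_k converges to a unit. *)
Require Import Defs.
From mathcomp Require Import all_boot all_order all_algebra.
From mathcomp Require Import all_classical all_reals all_analysis.
From mathcomp Require Import zify ring.

Set Implicit Arguments.
Unset Strict Implicit.
Unset Printing Implicit Defensive.

Import Order.TTheory GRing.Theory Num.Theory.

Local Open Scope classical_set_scope.
Local Open Scope ring_scope.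

(** * Normal forms in BS(m,n) *)

Section IntegerPowers.
Variable G : groupType.
Implicit Types (x y : G) (i j : int).

Lemma expgzS x i : expgz x (i + 1) = (x * expgz x i)%g.
Proof.
case: i => [n|[|n]].
- by rewrite -PoszD addn1 /= expgS.
- by rewrite /= expg1 mulgV.
- have -> : Negz n.+1 + 1 = Negz n by rewrite !NegzE; lia.
  by rewrite /= [(x ^+ n.+2)%g]expgSr invgM mulVKg.
Qed.

Lemma expgzD x i j : expgz x (i + j) = (expgz x i * expgz x j)%g.
Proof.
elim/int_rect: i => [|n IHn|n IHn]; first by rewrite add0r mul1g.
- have -> : n.+1%:Z + j = (n%:Z + j) + 1 by lia.
  have -> : n.+1%:Z = n%:Z + 1 by lia.
  by rewrite !expgzS IHn mulgA.
- apply: (mulgI x); rewrite -expgzS mulgA -expgzS.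
  have -> : - n.+1%:Z + j + 1 = - n%:Z + j by lia.
  by have -> : - n.+1%:Z + 1 = - n%:Z by lia.
Qed.

Lemma expgz1 x : expgz x 1 = x.
Proof. exact: expg1. Qed.

Lemma expgzN x i : expgz x (- i) = (expgz x i)^-1%g.
Proof. by apply: (mulgI (expgz x i)); rewrite -expgzD subrr mulgV. Qed.

Lemma expgzM x i j : expgz x (i * j) = expgz (expgz x i) j.
Proof.
elim/int_rect: j => [|n IHn|n IHn]; first by rewrite mulr0.
- have -> : n.+1%:Z = 1 + n%:Z by lia.
  by rewrite mulrDr mulr1 !expgzD IHn expgz1.
- have -> : - n.+1%:Z = - n%:Z + -1 by lia.
  by rewrite mulrDr mulrN1 !expgzD IHn !expgzN expgz1.
Qed.

Lemma expgz_conj x y i : expgz (x ^ y)%g i = (expgz x i ^ y)%g.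
Proof. by case: i => n /=; rewrite -?conjXg ?conjVg ?conjXg. Qed.

End IntegerPowers.

(** Evaluation in the presented group is the quotient map, whose kernel is the normal closure. *)
Lemma presented_trivial (k : nat) (Rel : set (free_group k)) (w : free_group k) :
  trivial_in (presented Rel) w <-> normal_closure Rel w.
Proof.
have quo_eval : forall u : free_group k,
    free_eval (fun i => quo_proj Rel (free_gen i)) u = quo_proj Rel u.
  move=> u; rewrite -[in RHS](free_eval_free_gen u) /free_eval.
  elim: (word_of u) => [|l v IHv]; first by rewrite !big_nil.
  rewrite !big_cons IHv -quo_projM; congr (_ * _)%g.
  by case: l => i [] //=; rewrite -quo_projV.
rewrite /trivial_in /= quo_eval; split=> [h|h].
  have /(quo_projP Rel 1%g w) := esym h.
  by rewrite invg1 mul1g.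
by apply/esym/quo_projP; rewrite invg1 mul1g.
Qed.

Lemma sub_modz_dvd (d k : int) : (d %| k - (k %% d)%Z)%Z.
Proof. by rewrite {1}(divz_eq k d) addrK dvdz_mull. Qed.

(* The residue of k modulo d closest to 0, so that a fixed integer is its own
   residue as soon as |d| is large. *)
Definition rep (d k : int) : int :=
  ((k + (`|d| %/ 2)%N%:Z) %% d)%Z - (`|d| %/ 2)%N%:Z.

Lemma rep_dvd d k : (d %| k - rep d k)%Z.
Proof.
by rewrite /rep opprB addrA sub_modz_dvd.
Qed.

Lemma rep_small d k : (2 * `|k| < `|d|)%N -> rep d k = k.
Proof.
move=> kd; rewrite /rep -modz_abs modz_small ?addrK//; apply/andP; split; lia.
Qed.

Lemma rep0 d : d != 0 -> rep d 0 = 0.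
Proof. by move=> d0; rewrite rep_small//; lia. Qed.

Lemma repD d q k : rep d (d * q + k) = rep d k.
Proof. by rewrite /rep -[d * q + k + _]addrA [d * q]mulrC modzMDl. Qed.

Lemma rep_bound d k : d != 0 -> (`|rep d k| <= `|d|)%N.
Proof.
move=> d0; rewrite /rep.
have := modz_ge0 (k + (`|d| %/ 2)%N) d0; have := ltz_mod (k + (`|d| %/ 2)%N) d0.
lia.
Qed.

Lemma rep_eq d j k : (d %| j - k)%Z -> rep d j = rep d k.
Proof. by move=> /dvdzP[q e]; rewrite -(repD d q k); congr rep; lia. Qed.

Lemma rep_eq0 d k : d != 0 -> (rep d k == 0) = (d %| k)%Z.
Proof.
move=> d0; apply/eqP/idP => [e|/dvdzP[q ->]].
  by have := rep_dvd d k; rewrite e subr0.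
by rewrite mulrC -[d * q]addr0 repD rep0.
Qed.

Lemma repK d k : rep d (rep d k) = rep d k.
Proof. by apply: rep_eq; rewrite -opprB rpredN rep_dvd. Qed.

(** * Action of words on normal forms *)

Section NormalForms.
Variables m n : int.
Hypotheses (m0 : m != 0) (n0 : n != 0).

(* In BS(m,n), b^(m q) is moved to the left through a as b^(n q), and b^(n q)
   through a^-1 as b^(m q).  With a^false = a and a^true = a^-1, the state
   (k, [:: (e1, s1); (e2, s2) ...]) stands for the normal form
   b^k a^e1 b^s1 a^e2 b^s2 ... of the HNN extension. *)
Definition modulus (e : bool) : int := if e then n else m.

Definition state : Type := (int * seq (bool * int))%type.

(** Left multiplication by a^e: the exponent splits as [modulus e] times q plus s, the first part
    crosses a^e, and b^s stays behind it. When s = 0 and the next letter is a^-e, the two letters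
    cancel. *)
Definition push_a (e : bool) (st : state) : state :=
  let s := rep (modulus e) st.1 in
  let k := modulus (~~ e) * ((st.1 - s) %/ modulus e)%Z in
  if st.2 is (e', s') :: L then
    if (e' == ~~ e) && (s == 0) then (k + s', L) else (k, (e, s) :: st.2)
  else (k, [:: (e, s)]).

Definition push_letter (l : letter 2) (st : state) : state :=
  if l.1 == ord0 then push_a l.2 st
  else ((if l.2 then st.1 - 1 else st.1 + 1), st.2).

(** Normal forms: exponents are the chosen representatives, and no a^e b^0 a^-e occurs. *)
Fixpoint valid_stack (L : seq (bool * int)) : bool :=
  if L is (e, s) :: L' then
    [&& rep (modulus e) s == s,
        (if L' is (e', _) :: _ then ~~ ((s == 0) && (e' == ~~ e)) else true) &
        valid_stack L']
  else true.

Lemma modulus_neq0 e : modulus e != 0.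
Proof. by case: e. Qed.

Lemma valid_push l st : valid_stack st.2 -> valid_stack (push_letter l st).2.
Proof.
case: st => k L; rewrite /push_letter /=; case: ifP => // _ vL.
rewrite /push_a /=; case: L vL => [_|[e' s'] L /= vL] /=; first by rewrite repK eqxx.
case: ifP => [_|h]; first by case/and3P: vL.
rewrite /= in vL *.
by rewrite repK eqxx /= [X in ~~ X]andbC h vL.
Qed.

Lemma push_aE e q s L : rep (modulus e) s = s ->
  push_a e (modulus e * q + s, L) =
  (if L is (e', s') :: L' then
     if (e' == ~~ e) && (s == 0) then (modulus (~~ e) * q + s', L')
     else (modulus (~~ e) * q, (e, s) :: L)
   else (modulus (~~ e) * q, [:: (e, s)])).
Proof.
by move=> es; rewrite /push_a /= repD es addrK mulKz // modulus_neq0.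
Qed.

(** This makes [run] an action of the free group. Without cancellation, the exponent left in front
    is a multiple of [modulus (~~ e)], so the inverse letter sees residue 0 and cancels what was
    just pushed. *)
Lemma push_letterK l st : valid_stack st.2 ->
  push_letter (inv_letter l) (push_letter l st) = st.
Proof.
case: st l => k L [i e] /= vL; rewrite /push_letter /=; case: (i == ord0); last first.
  by case: e => /=; rewrite ?addrK ?subrK.
have /dvdzP[q qE] := rep_dvd (modulus e) k.
have -> : k = modulus e * q + rep (modulus e) k by rewrite mulrC -qE subrK.
have := repK (modulus e) k; move: (rep _ k) => s es {k qE}.
rewrite push_aE //.
have r0 : rep (modulus (~~ e)) 0 = 0 by apply/rep0/modulus_neq0.
case: L vL => [|[e' s'] L] vL.
  by rewrite -[X in (X, _)]addr0 push_aE // negbK !eqxx.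
case: ifP => [/andP[/eqP ee' /eqP s0]|_]; last first.
  by rewrite -[X in (X, _)]addr0 push_aE // negbK !eqxx.
(* After a cancellation, s' is its own representative and [adj] forbids a second cancellation, so
   the inverse letter puts the removed entry back. *)
move: vL => /= /and3P[/eqP es' adj _]; rewrite ee' in es' adj *.
rewrite push_aE // negbK s0 addr0.
by case: L adj => [//|[e'' s''] L]; rewrite andbC negbK => /negPf ->.
Qed.

Definition run (w : seq (letter 2)) (st : state) : state := foldr push_letter st w.

Lemma valid_run w st : valid_stack st.2 -> valid_stack (run w st).2.
Proof. by move=> v; elim: w => //= l w; apply: valid_push. Qed.

Lemma run_push l w st : valid_stack st.2 ->
  run (push l w) st = push_letter l (run w st).
Proof.
move=> v; case: w => [|l' w] //=; case: eqP => [->|//].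
have := push_letterK (inv_letter l) (valid_run w v).
by rewrite inv_letterK /= => ->.
Qed.

Lemma runM (x y : free_group 2) st : valid_stack st.2 ->
  run (x * y)%g st = run x (run y st).
Proof.
move=> v; rewrite [word_of (x * y)%g]/=.
by elim: (word_of x) => //= l u IHu; rewrite run_push // IHu.
Qed.

Lemma runK (x : free_group 2) st : valid_stack st.2 -> run x^-1%g (run x st) = st.
Proof. by move=> v; rewrite -runM // mulVg. Qed.

Lemma runV_eq (x : free_group 2) st : valid_stack st.2 -> run x st = st ->
  run x^-1%g st = st.
Proof. by move=> v e; rewrite -{1}e runK. Qed.

Let a : free_group 2 := free_gen ord0.
Let b : free_group 2 := free_gen ord_max.

Lemma run_a st : run a st = push_a false st. Proof. by []. Qed.
Lemma run_aV st : run a^-1%g st = push_a true st. Proof. by []. Qed.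

Lemma run_bX z st : valid_stack st.2 -> run (expgz b z) st = (st.1 + z, st.2).
Proof.
case: st => k L v; elim/int_rect: z => [|i IHi|i IHi]; first by rewrite addr0.
- have -> : i.+1%:Z = 1 + i%:Z by lia.
  rewrite expgzD runM // IHi expgz1 /b /= /push_letter /=; congr (_, _); lia.
- have -> : - i.+1%:Z = - 1 + - i%:Z by lia.
  rewrite expgzD runM // IHi expgzN expgz1 /b /= /push_letter /=; congr (_, _); lia.
Qed.

(** The relation a b^m = b^n a read on states: a multiple of the modulus crosses the letter without
    changing the residue that is stored. *)
Lemma push_aD e q st : push_a e (modulus e * q + st.1, st.2) =
  (modulus (~~ e) * q + (push_a e st).1, (push_a e st).2).
Proof.
case: st => k L /=; rewrite /push_a /= repD.
have -> : modulus e * q + k - rep (modulus e) k =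
  q * modulus e + (k - rep (modulus e) k) by ring.
rewrite divzMDl ?modulus_neq0 // mulrDr.
by case: L => [|[e' s'] L] //=; case: ifP => _ //=; rewrite addrA.
Qed.

Lemma run_relator st : valid_stack st.2 -> run (BS_relator m n) st = st.
Proof.
move=> v; rewrite /BS_relator -/a -/b; set st' := run (expgz b n)^-1%g st.
have v' : valid_stack st'.2 by apply: valid_run.
have stE : st = run (expgz b n) st'.
  by rewrite /st' -runM // mulgV.
have va : valid_stack (run a^-1%g st').2 by apply: valid_run.
rewrite runM // -/st' !runM // run_bX // run_a.
have -> : (run a^-1%g st').1 + m = modulus false * 1 + (run a^-1%g st').1.
  by rewrite mulr1 addrC.
rewrite push_aD mulr1 -[push_a false _]run_a -runM // mulgV addrC.
by rewrite [in RHS]stE run_bX.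
Qed.

Lemma run_normal_closure w st : normal_closure [set BS_relator m n] w ->
  valid_stack st.2 -> run w st = st.
Proof.
move=> nw; elim: nw st =>
  {w} [x -> st v|st v|x y _ IHx _ IHy st v|x _ IHx st v|x y _ IHx st v] //.
- exact: run_relator.
- by rewrite runM // IHy // IHx.
- by apply: runV_eq => //; apply: IHx.
- rewrite /conjg !runM // IHx ?runK //; exact: valid_run.
Qed.

(** * Elements represented by normal forms in groups satisfying the relation *)

Section Evaluation.
Variables (G : groupType) (A B : G).
Hypothesis AB : (A * expgz B m)%g = (expgz B n * A)%g.

Let ae (e : bool) : G := if e then A^-1%g else A.

Definition stack_eval (L : seq (bool * int)) : G :=
  foldr (fun es x => ae es.1 * (expgz B es.2 * x))%g 1%g L.

Definition state_eval (st : state) : G := (expgz B st.1 * stack_eval st.2)%g.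

Lemma modulus_shift e q :
  (ae e * expgz B (modulus e * q))%g = (expgz B (modulus (~~ e) * q) * ae e)%g.
Proof.
have AmA : (expgz B n)%g = (expgz B m ^ A^-1)%g by rewrite conjgE invgK mulgA AB mulgK.
rewrite !expgzM; case: e => /=; rewrite AmA expgz_conj conjgE invgK; last first.
  by rewrite mulgA mulgVK.
by rewrite mulKg.
Qed.

Lemma state_eval_push l st : state_eval (push_letter l st) =
  ((if l.2 then (if l.1 == ord0 then A else B)^-1
    else (if l.1 == ord0 then A else B)) * state_eval st)%g.
Proof.
case: st l => k L [i e]; rewrite /push_letter /=; case: (i == ord0); last first.
  rewrite /state_eval /=; case: e => /=.
    by rewrite addrC expgzD expgzN expgz1 mulgA.
  by rewrite addrC expgzD expgz1 mulgA.
rewrite -/(ae e).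
have /dvdzP[q qE] := rep_dvd (modulus e) k.
have -> : k = modulus e * q + rep (modulus e) k by rewrite mulrC -qE subrK.
have := repK (modulus e) k; move: (rep _ k) => s es {k qE}.
rewrite push_aE // /state_eval /=.
have H : (expgz B (modulus (~~ e) * q) * stack_eval ((e, s) :: L) =
    ae e * (expgz B (modulus e * q + s) * stack_eval L))%g.
  by rewrite /= expgzD !mulgA modulus_shift.
case: L H => [|[e' s'] L] H //; case: ifP => // /andP[/eqP ee /eqP s0].
rewrite /= expgzD -!mulgA -[RHS]H /= s0 ee [expgz B 0]/= mul1g; congr (_ * _)%g.
by rewrite !mulgA; case: (e); rewrite /= ?mulgV ?mulVg !mul1g.
Qed.

End Evaluation.

(** Relators act trivially, which gives one direction. Conversely, the image of w in the quotient is
    the element represented by the state that w reaches, and the empty normal form represents 1. *)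
Lemma BS_trivial (R : realType) (w : free_group 2) :
  class_trivial (BS R m n) w <-> run w (0, [::]) = (0, [::]).
Proof.
rewrite /BS /=; split=> [/presented_trivial h|h]; first exact: run_normal_closure.
rewrite /trivial_in /=; set Rel := [set BS_relator m n].
pose A := quo_proj Rel a; pose B := quo_proj Rel b.
have projX z : expgz B z = quo_proj Rel (expgz b z).
  have pX i : quo_proj Rel (b ^+ i)%g = (B ^+ i)%g.
    elim: i => // i IHi; rewrite !expgS -IHi.
    exact: (esym (quo_projM Rel b _)).
  by case: z => i; rewrite /expgz -pX //; apply: quo_projV.
have AB : (A * expgz B m)%g = (expgz B n * A)%g.
  rewrite !projX; apply: etrans (quo_projM _ _ _) _.
  apply: etrans (esym (quo_projM _ _ _)); apply/esym/quo_projP.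
  (* This conjugate of the relator is (b^n a)^-1 (a b^m). *)
  have := nc_conj (expgz b n * a)%g (nc_incl (erefl : Rel (BS_relator m n))).
  by rewrite /conjg /BS_relator -/a -/b !mulgA mulgVK mulgVK.
suff H : free_eval (fun i => quo_proj Rel (free_gen i)) w =
     state_eval A B (run w (0, [::])) by rewrite H h /state_eval /= mulg1.
rewrite /free_eval; elim: (word_of w) => [|l v IHv] /=.
  by rewrite big_nil /state_eval /= mulg1.
rewrite big_cons state_eval_push // -IHv; congr (_ * _)%g.
have -> : (if l.1 == ord0 then A else B) = quo_proj Rel (free_gen l.1).
  case: eqP => [->//|ne]; congr (quo_proj _ (free_gen _)); apply: val_inj.
  by case: l ne => [[[|[|?]] ?] ?] //= ne; case: ne; apply: val_inj.
by [].
Qed.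

End NormalForms.

(** The relators for n and n' differ by a power of b, and b has infinite order. *)
Lemma BS_inj (R : realType) (m n n' : int) : m != 0 -> n != 0 -> n' != 0 ->
  BS R m n = BS R m n' -> n = n'.
Proof.
move=> m0 n0 n'0 e; pose b := free_gen (ord_max : 'I_2).
have : class_trivial (BS R m n) (BS_relator m n').
  by rewrite e; apply/presented_trivial; apply: nc_incl.
have -> : BS_relator m n' = (BS_relator m n * (expgz b n * (expgz b n')^-1))%g.
  by rewrite /BS_relator -/b !mulgA mulgVK.
move=> /(BS_trivial m0 n0); rewrite runM // run_relator ?valid_run // -expgzN.
by rewrite -expgzD run_bX // => -[/eqP]; rewrite add0r subr_eq0 => /eqP.
Qed.

(** * Large values of n *)

Section SymbolicRun.
Variable m : int.
Hypothesis m0 : m != 0.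

(* P(n/m); the integer divisions by m are exact when integral_at n P holds. *)
Fixpoint value (n : int) (P : seq int) : int :=
  if P is c :: Q then c + n * (value n Q %/ m)%Z else 0.

Fixpoint integral_at (n : int) (P : seq int) : bool :=
  if P is _ :: Q then (m %| value n Q)%Z && integral_at n Q else true.

Definition add_head (r : int) (P : seq int) : seq int :=
  if P is c :: Q then (r + c) :: Q else [:: r].

Definition symbolic_state : Type := (seq int * seq (bool * int))%type.

(* Mimics push_letter when the exponent is given by a polynomial P whose value
   has residue s modulo m.  Modulo n, this value is the constant term of P. *)
Definition symbolic_push (l : letter 2) (s : int) (st : symbolic_state) :
    symbolic_state :=
  let: (P, L) := st in
  if l.1 != ord0 then (add_head (if l.2 then -1 else 1) P, L) else
  let s' := if l.2 then head 0 P else s in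
  let Q := if l.2 then behead P else 0 :: add_head (- s) P in
  if L is (e, r) :: L' then
    if (e == ~~ l.2) && (s' == 0) then (add_head r Q, L') else (Q, (l.2, s') :: L)
  else (Q, [:: (l.2, s')]).

Definition bounded (B : nat) (st : symbolic_state) : bool :=
  all (fun c => `|c| <= B)%N st.1 && all (fun er => `|er.2| <= B)%N st.2.

Lemma value_add_head n r P : value n (add_head r P) = r + value n P.
Proof. by case: P => [|c Q] /=; rewrite ?div0z ?mulr0 ?addrA. Qed.

Lemma integral_add_head n r P : integral_at n P -> integral_at n (add_head r P).
Proof. by case: P => //= _; rewrite dvdz0. Qed.

Lemma value_head n P : n != 0 -> integral_at n P ->
  value n P = n * (value n (behead P) %/ m)%Z + head 0 P /\
  (m %| value n (behead P))%Z.
Proof.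
move=> n0; case: P => [|c Q] /=; first by rewrite div0z mulr0 dvdz0.
by case/andP => mQ _; rewrite addrC.
Qed.

(** The value is the constant term plus a multiple of n, and the bound on [head 0 P] makes this term
    its own representative modulo n. Crossing a^-1 then drops the constant term; crossing a
    subtracts s and multiplies by n/m, which shifts the coefficients. *)
Lemma value_symbolic_push n P L l : n != 0 -> integral_at n P ->
  (2 * `|head 0%R P| < `|n|)%N ->
  let st := symbolic_push l (rep m (value n P)) (P, L) in
  push_letter m n l (value n P, L) = (value n st.1, st.2) /\ integral_at n st.1.
Proof.
move=> n0 iP hP; case: l => i e; rewrite /push_letter /=.
case: (i == ord0) => /=; last first.
  by case: e; rewrite value_add_head integral_add_head // addrC.
set Q := if e then _ else _; set s := if e then _ else _.
have [kE iQ] : value n Q = modulus m n (~~ e) *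
      ((value n P - rep (modulus m n e) (value n P)) %/ modulus m n e)%Z /\
    integral_at n Q.
  rewrite /Q; case: (e) => /=.
    have [PE mQ] := value_head n0 iP.
    rewrite {1}PE [in rep _ _]PE repD rep_small // addrK mulKz //.
    rewrite [m * _]mulrC divzK //; split=> //.
    by case: (P) iP => //= c Q' /andP[].
  rewrite add0r value_add_head integral_add_head // andbT addrC; split=> //.
  by have := rep_dvd m (value n P).
have sE : s = rep (modulus m n e) (value n P).
  rewrite /s; case: (e) => //=.
  by have [-> _] := value_head n0 iP; rewrite repD rep_small.
rewrite /push_a /= -kE -sE; case: L => [|[e' r] L] //=.
by case: ifP => _ //=; rewrite value_add_head integral_add_head // addrC.
Qed.

(** A modified coefficient is an old one plus a stack exponent, a residue modulo m, or 1 or -1; one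
    bound covers all cases. *)
Lemma bounded_symbolic_push B l s st : (`|s| <= `|m|)%N -> bounded B st ->
  bounded (2 * B + `|m| + 1) (symbolic_push l s st).
Proof.
case: st => P L sm; rewrite /bounded /symbolic_push /= => /andP[bP bL].
set B' := (2 * B + _ + 1)%N.
have wide c : (`|c| <= B)%N -> (`|c| <= B')%N by rewrite /B'; lia.
have bP' : all (fun c => `|c| <= B')%N P by apply: sub_all bP.
have bL' : all (fun er => `|er.2| <= B')%N L by apply: sub_all bL => -[].
have bound_head r Q : (`|r| <= B + `|m| + 1)%N -> all (fun c => `|c| <= B)%N Q ->
    all (fun c => `|c| <= B')%N (add_head r Q).
  case: Q => [|c Q] /=; first by rewrite /B'; lia.
  move=> rB /andP[cB QB]; apply/andP; split; first by rewrite /B'; lia.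
  exact: sub_all QB.
case: (l.1 == ord0) => /=; last first.
  by rewrite bL' andbT bound_head //; case: (l.2) => /=; lia.
have bh : (`|head 0%R P| <= B)%N by case: (P) bP => //= c Q /andP[].
have bb : all (fun c => `|c| <= B)%N (behead P) by case: (P) bP => //= c Q /andP[].
have bb' : all (fun c => `|c| <= B')%N (behead P) by apply: sub_all bb.
have bs : (`|s| <= B')%N by rewrite /B'; lia.
have bs' : all (fun c => `|c| <= B')%N (add_head (- s) P) by apply: bound_head; lia.
case: L bL bL' => [|[e r] L] /=.
  by case: (l.2) => /= _ _; rewrite ?bb' ?(wide _ bh) ?bs ?bs'.
move=> /andP[rB LB] /andP[rB' LB'].
case: ifP => _ /=; rewrite ?LB' ?rB' ?andbT.
  case: (l.2) => /=; first by apply: bound_head => //; lia.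
  by rewrite bs' addr0 rB'.
by case: (l.2) => /=; rewrite ?bb' ?bs' ?bs ?(wide _ bh).
Qed.

Lemma size_symbolic_push k l s st : (0 < k)%N -> (size st.1 <= k)%N ->
  (size (symbolic_push l s st).1 <= k.+1)%N.
Proof.
have size_head r Q j : (0 < j)%N -> (size Q <= j)%N -> (size (add_head r Q) <= j)%N.
  by case: Q.
case: st => P L k0 /= Pk; rewrite /symbolic_push.
case: (l.1 == ord0) => /=; last by apply: size_head => //; lia.
set Q := if l.2 then _ else _.
have Qk : (size Q <= k.+1)%N.
  rewrite /Q; case: (l.2); first by rewrite size_behead; lia.
  by rewrite /= ltnS size_head.
by case: L => [|[e r] L] //=; case: ifP => _ //=; apply: size_head.
Qed.

(** Each division by m costs one power of m, hence the [size P] extra powers. *)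
Lemma value_congr j n n' P : integral_at n P -> integral_at n' P ->
  (m ^+ (j + size P) %| n - n')%Z -> (m ^+ j %| value n P - value n' P)%Z.
Proof.
elim: P j => [|c Q IHQ] j /=; first by rewrite subrr dvdz0.
move=> /andP[/dvdzP[y yE] iQ] /andP[/dvdzP[y' yE'] iQ'].
rewrite addnS -addSn => nn'.
have := IHQ j.+1 iQ iQ' nn'; rewrite yE yE' !mulzK // -mulrBl exprSr dvdz_mul2r //.
move=> yy'.
have -> : c + n * y - (c + n' * y') = n * (y - y') + (n - n') * y' by ring.
apply: rpredD; [exact: dvdz_mull | apply: dvdz_mulr].
by apply: dvdz_trans nn'; apply: dvdz_exp2l; rewrite addSn ltnW // ltnS leq_addr.
Qed.

(** If the value vanishes, n divides the constant term, which is smaller than |n| and so is 0; the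
    tail then vanishes too. *)
Lemma value_eq0 B n P : integral_at n P -> all (fun c => `|c| <= B)%N P ->
  (B < `|n|)%N -> (value n P == 0) = all (fun c => c == 0) P.
Proof.
move=> + + Bn; elim: P => //= c Q IHQ /andP[/dvdzP[y yE] iQ] /andP[cB QB].
rewrite -IHQ // yE mulzK // mulf_eq0 (negPf m0) orbF.
apply/eqP/andP => [e|[/eqP-> /eqP->]]; last by rewrite mulr0.
have n0 : n != 0 by lia.
have c0 : c = 0.
  have : (n %| c)%Z by apply/dvdzP; exists (- y); lia.
  move=> /dvdzP[[[|z]|z] zE]; rewrite zE ?mul0r // in cB *; exfalso;
    move: cB; rewrite abszM; nia.
by move: e; rewrite c0 add0r => /eqP; rewrite mulf_eq0 (negPf n0).
Qed.

Definition run_bound (k : nat) : nat := iter k (fun B => 2 * B + `|m| + 1)%N 0%N.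

(** Both runs follow the same symbolic computation: residues modulo m agree by congruence, and
    residues modulo n and n' are the same constant term. *)
Lemma run_simulation w n n' :
  (2 * run_bound (size w) < `|n|)%N -> (2 * run_bound (size w) < `|n'|)%N ->
  (m ^+ (size w + 2) %| n - n')%Z ->
  exists P L, [/\ run m n w (0, [::]) = (value n P, L) /\ integral_at n P,
                  run m n' w (0, [::]) = (value n' P, L) /\ integral_at n' P,
                  bounded (run_bound (size w)) (P, L) & (size P <= (size w).+1)%N].
Proof.
elim: w => [|l w IHw] /=.
  by exists [:: 0], [::]; rewrite /= div0z !mulr0 dvdz0.
rewrite -/(run_bound _) => hn hn' nn'.
have [||| P [L [[rn iP] [rn' iP'] bPL sP]]] := IHw; [lia|lia| |].
  by apply: dvdz_trans nn'; apply: dvdz_exp2l.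
have hP : (`|head 0%R P| <= run_bound (size w))%N.
  by case/andP: bPL; case: (P) => //= c Q /andP[].
(* P has at most [(size w).+1] coefficients and one more power of m is wanted, whence the exponent
   [size w + 2]. *)
have sE : rep m (value n P) = rep m (value n' P).
  apply: rep_eq; rewrite -[m]expr1; apply: value_congr => //.
  by apply: dvdz_trans nn'; apply: dvdz_exp2l; lia.
set st := symbolic_push l (rep m (value n P)) (P, L).
exists st.1, st.2; rewrite rn rn'; split.
- by apply: value_symbolic_push => //; lia.
- by rewrite /st sE; apply: value_symbolic_push => //; lia.
- rewrite -surjective_pairing; apply: bounded_symbolic_push => //.
  exact: rep_bound.
- exact: size_symbolic_push.
Qed.

Lemma run_bound_mono j k : (j <= k)%N -> (run_bound j <= run_bound k)%N.
Proof.
elim: k => [|k IHk]; first by rewrite leqn0 => /eqP->.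
rewrite leq_eqVlt => /predU1P[->//|/IHk h]; apply: leq_trans h _.
by rewrite /run_bound /= -/(run_bound k); lia.
Qed.

End SymbolicRun.

Section Agreement.
Variable R : realType.

Definition agree (k : nat) (x y : marked_space R 2) : Prop :=
  forall w : free_group 2, (size (word_of w) <= k)%N ->
    (class_trivial x w <-> class_trivial y w).

(** A word of length at most k ends in a common symbolic state, and is trivial when the stack is
    empty and all coefficients vanish, a condition free of n. *)
Lemma BS_agree (m : int) (k : nat) : m != 0 ->
  exists N : nat, forall n n' : int, (N <= `|n|)%N -> (N <= `|n'|)%N ->
    (m ^+ N %| n - n')%Z -> agree k (BS R m n) (BS R m n').
Proof.
move=> m0; exists (maxn (2 * run_bound m k).+1 (k + 2)) => n n' nN n'N nn' w wk.
have wB : (run_bound m (size w) <= run_bound m k)%N by apply: run_bound_mono.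
have n0 : n != 0 by lia.
have n'0 : n' != 0 by lia.
have [||| P [L [[rn iP] [rn' iP'] bPL sP]]] := @run_simulation m m0 w n n'; [lia|lia| |].
  by apply: dvdz_trans nn'; apply: dvdz_exp2l; lia.
have [bP _] := andP bPL.
have nB : (run_bound m (size w) < `|n|)%N by lia.
have n'B : (run_bound m (size w) < `|n'|)%N by lia.
have h := value_eq0 m0 iP bP nB; have h' := value_eq0 m0 iP' bP n'B.
rewrite !BS_trivial // rn rn'.
split=> -[/eqP v ->]; congr (_, _); apply/eqP; first by rewrite h' -h.
by rewrite h -h'.
Qed.

End Agreement.

(** * Words detecting n modulo powers of m *)

Section WordSize.
Variable k : nat.
Implicit Types x y : free_group k.

Lemma size_push (l : letter k) w : (size (push l w) <= (size w).+1)%N.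
Proof. by case: w => //= l' w; case: ifP => //= _; rewrite -addn2 leq_addr. Qed.

Lemma size_free_mul x y :
  (size (word_of (x * y)%g) <= size (word_of x) + size (word_of y))%N.
Proof.
rewrite [word_of (x * y)%g]/=; elim: (word_of x) => //= l u IHu.
by apply: leq_trans (size_push _ _) _; rewrite addSn ltnS.
Qed.

Lemma size_free_inv x : size (word_of x^-1%g) = size (word_of x).
Proof. by rewrite /= /inv_word size_rev size_map. Qed.

Lemma size_free_expgz (i : 'I_k) (z : int) :
  (size (word_of (expgz (free_gen i) z)) <= `|z|)%N.
Proof.
have sizeX n : (size (word_of (free_gen i ^+ n)%g) <= n)%N.
  elim: n => // n IHn; rewrite expgS; apply: leq_trans (size_free_mul _ _) _.
  by rewrite add1n ltnS.
by case: z => n; rewrite /expgz ?size_free_inv.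
Qed.

End WordSize.

(** * Ladders of divisibilities tested by words *)

Section Ladder.
Variable m : int.
Hypothesis m0 : m != 0.

Let a : free_group 2 := free_gen ord0.
Let b : free_group 2 := free_gen ord_max.

(* In BS(m,n), the word ladder_word cs equals b^(ladder_exp n cs) as long as the
   exponents of its tails are multiples of m.  The word ladder_test cs tells
   whether m divides the exponent: conjugating b^x by a gives an element that
   commutes with b if and only if m divides x. *)
Fixpoint ladder_word (cs : seq int) : free_group 2 :=
  if cs is c :: cs' then (a * (ladder_word cs' * (a^-1 * expgz b c)))%g
  else expgz b m.

Fixpoint ladder_exp (n : int) (cs : seq int) : int :=
  if cs is c :: cs' then n * (ladder_exp n cs' %/ m)%Z + c else m.

Fixpoint ladder_ok (n : int) (cs : seq int) : bool :=
  if cs is _ :: cs' then (m %| ladder_exp n cs')%Z && ladder_ok n cs' else true.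

Definition ladder_test (cs : seq int) : free_group 2 :=
  let t := (a * (ladder_word cs * a^-1))%g in ((b * t)^-1 * (t * b))%g.

Lemma run_ladder_conj (n x : int) (w : free_group 2) (st : state) :
  n != 0 -> valid_stack m n st.2 -> (m %| x)%Z ->
  (forall st', valid_stack m n st'.2 -> run m n w st' = (x + st'.1, st'.2)) ->
  run m n (a * (w * a^-1))%g st = (n * (x %/ m)%Z + st.1, st.2).
Proof.
move=> n0 v mx wE; have va : valid_stack m n (run m n a^-1%g st).2 by apply: valid_run.
rewrite !runM // wE // -[in X in (X + _, _)](divzK mx) mulrC run_a.
have := push_aD m0 n0 false (x %/ m)%Z (run m n a^-1%g st); rewrite [modulus _ _ _]/= => ->.
by rewrite -[push_a _ _ false _]run_a -runM // mulgV.
Qed.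

Lemma run_ladder n cs st : n != 0 -> valid_stack m n st.2 -> ladder_ok n cs ->
  run m n (ladder_word cs) st = (ladder_exp n cs + st.1, st.2).
Proof.
move=> n0; elim: cs st => [|c cs IHcs] st v; first by rewrite run_bX // addrC.
move=> /andP[mx ok]; rewrite [ladder_exp _ _]/=.
have -> : ladder_word (c :: cs) = (a * (ladder_word cs * a^-1) * expgz b c)%g.
  by rewrite -!mulgA.
rewrite runM // (@run_ladder_conj _ (ladder_exp n cs)) ?valid_run //; last first.
  by move=> st' v'; apply: IHcs.
by rewrite run_bX //=; congr (_, _); lia.
Qed.

Lemma ladder_testP n cs : (1 < `|n|)%N -> ladder_ok n cs ->
  run m n (ladder_test cs) (0, [::]) = (0, [::]) <-> (m %| ladder_exp n cs)%Z.
Proof.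
move=> n1 ok; have n0 : n != 0 by lia.
rewrite /ladder_test; set t := (a * (_ * _))%g; set x := ladder_exp n cs.
have -> : run m n ((b * t)^-1 * (t * b))%g (0, [::]) = (0, [::]) <->
    run m n t (run m n b (0, [::])) = run m n b (run m n t (0, [::])).
  rewrite -[run _ _ t (run _ _ b _)]runM // -[run _ _ b (run _ _ t _)]runM //.
  split=> [h|e]; last by rewrite runM // e runK.
  have := congr1 (run m n (b * t)%g) h.
  by rewrite -[LHS]runM // mulVKg.
have wE st' : valid_stack m n st'.2 ->
    run m n (ladder_word cs) st' = (x + st'.1, st'.2).
  by move=> v; apply: run_ladder.
have bE st' : valid_stack m n st'.2 -> run m n b st' = (st'.1 + 1, st'.2).
  by move=> v; have := run_bX m0 n0 1 v; rewrite expgz1.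
split=> [|mx]; last first.
  rewrite !(@run_ladder_conj n x) ?valid_run // !bE ?valid_run //=.
  by rewrite addrA.
rewrite -(rep_eq0 _ m0); apply: contraPT => /negPf sx.
(* When m does not divide x, nothing cancels on either side. Comparing the exponents stored after
   a^-1 gives [rep n 1 = 0], so n divides 1. *)
rewrite /t !bE ?valid_run // !runM ?valid_run // !wE ?valid_run // !run_a !run_aV.
rewrite /push_a /= rep0 // subrr div0z mulr0 addr0 !add0r.
rewrite [x + _]addrC repD sx => -[_ r0]; move: n1.
have := rep_dvd n 1; rewrite r0 subr0 => /dvdzP[q qE].
have : (`|q| * `|n|)%N = 1%N by rewrite -abszM -qE.
by move=> /eqP; rewrite muln_eq1 => /andP[_ /eqP->].
Qed.

(** The factor u follows the recursion u -> n u + m^i y', where m y' is the previous exponent for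
    n'. Modulo m it is multiplied by n once i > 0, so it stays prime to m. *)
Lemma ladder_exp_diff n n' cs : ladder_ok n cs -> ladder_ok n' cs ->
  coprimez n m -> exists u : int,
  m ^+ size cs * (ladder_exp n cs - ladder_exp n' cs) = m * (n - n') * u /\
  (if cs is [::] then u = 0 else coprimez u m).
Proof.
move=> + + nm; elim: cs => [_ _|c cs IHcs] /=.
  by exists 0; rewrite subrr !mulr0.
move=> /andP[/dvdzP[y yE] ok] /andP[/dvdzP[y' yE'] ok'].
have [u [uE um]] := IHcs ok ok'.
exists (n * u + m ^+ size cs * y'); split.
  have {}uE : m ^+ size cs * (y - y') = (n - n') * u.
    apply: (mulfI m0); rewrite yE yE' in uE; rewrite [RHS]mulrA -uE; ring.
  rewrite yE yE' !mulzK // exprS.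
  have -> : n * y + c - (n' * y' + c) = n * (y - y') + (n - n') * y' by ring.
  have -> : m * m ^+ size cs * (n * (y - y') + (n - n') * y') =
    m * (n * (m ^+ size cs * (y - y')) + (n - n') * (m ^+ size cs * y')) by ring.
  by rewrite uE; ring.
(* On the first rung the exponent is m, so y' = 1 and u passes from 0 to 1. *)
case: cs {IHcs uE} => [|c' cs] in um yE yE' ok ok' *.
  have /eqP : m * 1 = m * y' by rewrite mulr1 [RHS]mulrC -yE'.
  rewrite (inj_eq (mulfI m0)) => /eqP <-.
  by rewrite um mulr0 add0r mulr1 expr0 coprimezE coprime1n.
rewrite /= exprS -mulrA coprimez_sym /coprimez addrC mulrC gcdzMDl -/(coprimez _ _).
by rewrite coprimezMr !(coprimez_sym m) nm.
Qed.

(** The bound depends on m and h only, so a single radius serves for all n. *)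
Lemma size_ladder_word cs h : (size cs <= h)%N -> all (fun c => `|c| <= `|m|)%N cs ->
  (size (word_of (ladder_word cs)) <= `|m| + h * (`|m| + 2))%N.
Proof.
elim: cs h => [|c cs IHcs] h.
  by move=> _ _; apply: leq_trans (size_free_expgz _ _) (leq_addr _ _).
case: h => // h sh /andP[cm csm]; rewrite mulSn.
have := IHcs h sh csm; move: (h * _)%N => B sW.
have sc := size_free_expgz (ord_max : 'I_2) c.
have sW' := leq_add sW (leq_trans (size_free_mul a^-1%g _) (leq_add (leqnn _) sc)).
have := leq_add (leqnn (size (word_of a))) (leq_trans (size_free_mul _ _) sW').
move/(leq_trans (size_free_mul _ _)) => h'; apply: leq_trans h' _.
rewrite size_free_inv (_ : size (word_of a) = 1%N) //; lia.
Qed.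

Lemma size_ladder_test cs h : (size cs <= h)%N -> all (fun c => `|c| <= `|m|)%N cs ->
  (size (word_of (ladder_test cs)) <= 2 * (`|m| + h * (`|m| + 2)) + 6)%N.
Proof.
move=> sh csm; have := size_ladder_word sh csm; rewrite /ladder_test.
set t := (a * _)%g; move: (_ + _)%N => B sB.
have sb : size (word_of b) = 1%N by [].
have st : (size (word_of t) <= B + 2)%N.
  apply: (@leq_trans (1 + (B + 1))%N); last by lia.
  apply: leq_trans (size_free_mul _ _) (leq_add _ _) => //.
  by apply: leq_trans (size_free_mul _ _) (leq_add _ _); rewrite ?size_free_inv.
have /leq_trans-> // := size_free_mul (b * t)^-1%g (t * b)%g; rewrite size_free_inv.
have := leq_add (size_free_mul b t) (size_free_mul t b); rewrite sb.
by move/leq_trans; apply; lia.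
Qed.

Lemma ladder_exists n h : coprimez n m ->
  exists cs, [/\ size cs = h, all (fun c => `|c| <= `|m|)%N cs, ladder_ok n cs &
                 (m %| ladder_exp n cs)%Z].
Proof.
move=> nm; elim: h => [|h [cs [sh csm ok mx]]]; first by exists [::].
pose c := (- (n * (ladder_exp n cs %/ m)%Z) %% m)%Z.
exists (c :: cs); rewrite /= sh csm mx ok andbT; split=> //.
  have := modz_ge0 (- (n * (ladder_exp n cs %/ m)%Z)) m0.
  have := ltz_mod (- (n * (ladder_exp n cs %/ m)%Z)) m0.
  rewrite -/c; lia.
have := sub_modz_dvd m (- (n * (ladder_exp n cs %/ m)%Z)).
by rewrite -/c -opprD rpredN.
Qed.

Lemma BS_agree_congr (R : realType) (h : nat) : exists k : nat,
  forall n n' : int, coprimez n m -> (1 < `|n|)%N -> (1 < `|n'|)%N ->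
    agree k (BS R m n) (BS R m n') -> (m ^+ h %| n - n')%Z.
Proof.
exists (2 * (`|m| + h * (`|m| + 2)) + 6)%N => n n' nm n1 n'1 nn'.
have n0 : n != 0 by lia.
have n'0 : n' != 0 by lia.
have [cs [sh csm ok mx]] := ladder_exists h nm.
(* The tests, trivial in BS(m,n), are short enough to be trivial in BS(m,n'); rung by rung, n'
   satisfies the same divisibilities. *)
have [ok' mx'] : ladder_ok n' cs /\ (m %| ladder_exp n' cs)%Z.
  have : (size cs <= h)%N by rewrite sh.
  elim: (cs) csm ok mx => [|c cs' IHcs] csm ok mx sh'.
    split=> //; exact: dvdzz.
  have ok' : ladder_ok n' (c :: cs').
    move: csm ok => /= /andP[_ csm] /andP[mx' ok].
    by have [-> ->] := IHcs csm ok mx' (ltnW sh').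
  split=> //; apply/(ladder_testP n'1 ok')/(BS_trivial m0 n'0 R)/nn'.
    exact: size_ladder_test.
  exact/(BS_trivial m0 n0 R)/(ladder_testP n1 ok).
have [u [uE um]] := ladder_exp_diff ok ok' nm.
case: cs um => [|c cs] um in sh csm ok mx ok' mx' uE *.
  by rewrite -sh expr0 dvd1z.
have umh : coprimez (m ^+ h) u by rewrite coprimezXl // coprimez_sym.
(* Both final exponents are multiples of m, so m^h divides (n - n') u with u prime to m. *)
rewrite -(Gauss_dvdzl _ umh); apply/dvdzP.
have /dvdzP[y yE] := mx; have /dvdzP[y' yE'] := mx'.
exists (y - y'); apply: (mulfI m0); rewrite mulrA -uE yE yE' sh; ring.
Qed.

End Ladder.

(** * Residues and topologies *)

Lemma initial_cvg (S : choiceType) (T : topologicalType) (f : S -> T)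
    (F : set_system S) (s : initial_topology f) :
  Filter F -> f x @[x --> F] --> f s -> F --> s.
Proof.
move=> FF fF U; rewrite nbhsE; case=> O [ [V oV VO] Os] OU.
apply: (filterS OU); rewrite -VO.
by apply: fF; apply: open_nbhs_nbhs; split=> //; rewrite -VO in Os.
Qed.

Section PadicLevels.
Variable m : int.
Hypothesis m0 : m != 0.
Implicit Types (x y : padic m) (h : nat) (n : int).

(** An integer representative of level h, which turns congruences with x into divisibilities in
    Z. *)
Definition residue x h : int := Posz (padic_lvl x h : 'I_(`|m| ^ h)%N.-1.+1).

Lemma card_lvl h : (`|m| ^ h)%N.-1.+1 = (`|m| ^ h)%N.
Proof. by rewrite prednK // expn_gt0; apply/orP; left; lia. Qed.

Lemma expz_neq0 h : m ^+ h != 0.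
Proof. by rewrite expf_neq0. Qed.

Lemma residue_ge0 x h : 0 <= residue x h. Proof. by []. Qed.

Lemma residue_lt x h : residue x h < `|m ^+ h|.
Proof.
rewrite -abszE abszX /residue ltz_nat.
by rewrite -[X in (_ < X)%N]card_lvl; apply: ltn_ord.
Qed.

Lemma dvd_modn_sub h (k : nat) : (m ^+ h %| k%:Z - (k %% (`|m| ^ h)%N.-1.+1)%N%:Z)%Z.
Proof.
rewrite card_lvl -modz_nat dvdzE abszX -[X in (X %| _)%N]/(`|(`|m| ^ h)%N%:Z|%N).
by rewrite -dvdzE sub_modz_dvd.
Qed.

Lemma residueD x y h : (m ^+ h %| residue x h + residue y h - residue (x + y) h)%Z.
Proof. by rewrite -PoszD dvd_modn_sub. Qed.

Lemma residueM x y h : (m ^+ h %| residue x h * residue y h - residue (x * y) h)%Z.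
Proof. by rewrite -PoszM dvd_modn_sub. Qed.

Lemma residue0 h : residue 0 h = 0. Proof. by []. Qed.

Lemma residue1 h : (m ^+ h %| 1 - residue 1%R h)%Z.
Proof. exact: (dvd_modn_sub h 1). Qed.

Lemma residue_eq x y h : (m ^+ h %| residue x h - residue y h)%Z <->
  padic_lvl x h = padic_lvl y h.
Proof.
split=> [/dvdzP[q qE]|e]; last by rewrite /residue e subrr dvdz0.
suff : residue x h = residue y h.
  by rewrite /residue => -[e]; apply: val_inj.
have [q0|q0] := eqVneq q 0; first by lia.
have := congr1 (fun z => `|z|%R) qE; rewrite normrM => absE.
have : 1 <= `|q|%R by lia.
have := residue_lt x h; have := residue_lt y h.
have := residue_ge0 x h; have := residue_ge0 y h.
move: absE; move: (`|m ^+ h|) (`|q|%R) => M Q; nia.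
Qed.

Lemma residue_le x h h' : (h <= h')%N ->
  (m ^+ h %| residue x h' - residue x h)%Z.
Proof.
move=> /subnK <-; elim: (h' - h)%N => [|k IHk]; first by rewrite add0n subrr dvdz0.
have -> : residue x (k.+1 + h) - residue x h =
  (residue x (k + h).+1 - residue x (k + h)) + (residue x (k + h) - residue x h).
  by rewrite addSn; ring.
rewrite rpredD //; apply: (@dvdz_trans (m ^+ (k + h))).
  by apply: dvdz_exp2l; rewrite leq_addl.
rewrite [residue x (k + h)]/residue -[padic_lvl x (k + h)%N](padic_lvlP x).
exact: dvd_modn_sub.
Qed.

Lemma residue_int n h : (m ^+ h %| n - residue (n%:~R) h)%Z.
Proof.
elim/int_rect: n => [|n IHn|n IHn]; first by rewrite residue0 subrr dvdz0.
- rewrite -addn1 PoszD rmorphD /=.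
  have := residueD (n%:Z%:~R) 1 h; have := residue1 h.
  move=> /dvdzP[q1 e1] /dvdzP[q2 e2]; have /dvdzP[q3 e3] := IHn.
  by apply/dvdzP; exists (q1 + q2 + q3); rewrite !mulrDl -e1 -e2 -e3; ring.
- have -> : - n.+1%:Z = - n%:Z - 1 by lia.
  have := residueD ((- n%:Z - 1)%:~R) 1 h; rewrite [in _ + 1]rmorphB /= subrK.
  have /dvdzP[q1 e1] := residue1 h; move=> /dvdzP[q2 e2]; have /dvdzP[q3 e3] := IHn.
  apply/dvdzP; exists (q3 - q2 - q1); rewrite !mulrBl -e1 -e2 -e3; ring.
Qed.

Lemma lvl_int n x h :
  (m ^+ h %| n - residue x h)%Z <-> padic_lvl (n%:~R) h = padic_lvl x h.
Proof.
rewrite -residue_eq; have := residue_int n h => nn.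
have -> : n - residue x h = (n - residue (n%:~R) h) + (residue (n%:~R) h - residue x h).
  by ring.
by rewrite rpredDl.
Qed.

Lemma approx_exists x h (B : nat) :
  exists n : int, (B <= `|n|)%N /\ (m ^+ h %| n - residue x h)%Z.
Proof.
exists (residue x h + B%:Z * `|m ^+ h|); split; last first.
  by rewrite addrAC subrr add0r dvdz_mull // dvdzE absz_id.
have : 0 < `|m ^+ h| by rewrite normr_gt0 expz_neq0.
have := residue_ge0 x h; move: (`|m ^+ h|) => M; nia.
Qed.

Lemma approx_le x n h h' : (h <= h')%N -> (m ^+ h' %| n - residue x h')%Z ->
  (m ^+ h %| n - residue x h)%Z.
Proof.
move=> hh' nx.
have -> : n - residue x h = (n - residue x h') + (residue x h' - residue x h) by ring.
rewrite rpredD ?residue_le //.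
by apply: dvdz_trans nx; apply: dvdz_exp2l.
Qed.

Lemma coprimez_congr n n' : (m %| n - n')%Z -> coprimez n m = coprimez n' m.
Proof.
move=> /dvdzP[q qE]; have -> : n = q * m + n' by rewrite -qE subrK.
by rewrite coprimez_sym /coprimez gcdzMDl -/(coprimez _ _) coprimez_sym.
Qed.

Lemma unit_coprime x n h : padic_units m x -> (0 < h)%N ->
  (m ^+ h %| n - residue x h)%Z -> coprimez n m.
Proof.
move=> [y xy] h0 nx.
have m_mh : (m %| m ^+ h)%Z by rewrite -[X in (X %| _)%Z]expr1 dvdz_exp2l.
rewrite (coprimez_congr (dvdz_trans m_mh nx)).
have /dvdzP[p pE] := residueM x y h; have /dvdzP[q qE] := residue1 h.
have /dvdzP[r rE] := m_mh; rewrite xy in pE.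
apply/coprimezP; exists (residue y h, (q - p) * r); rewrite /= -mulrA -rE.
by rewrite mulrBl -pE -qE; ring.
Qed.

(** Bezout inverts x at each level; uniqueness of inverses makes the inverses compatible. *)
Lemma coprime_unit x :
  (forall h, coprimez (residue x h) (m ^+ h)) -> padic_units m x.
Proof.
move=> cx.
have inv h : exists z : zmod (`|m| ^ h)%N, padic_lvl x h * z = 1.
  have /coprimezP[ [u v] /= uv] := cx h.
  exists (padic_lvl (u%:~R : padic m) h).
  have -> : padic_lvl x h * padic_lvl (u%:~R : padic m) h =
    padic_lvl (x * u%:~R) h by [].
  have -> : (1 : zmod (`|m| ^ h)%N) = padic_lvl (1 : padic m) h by [].
  apply/residue_eq.
  have /dvdzP[p pE] := residueM x (u%:~R) h; have /dvdzP[q qE] := residue1 h.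
  have /dvdzP[r rE] := residue_int u h.
  apply/dvdzP; exists (q - v - p - residue x h * r).
  have -> : residue (x * u%:~R) h =
    residue x h * residue (u%:~R) h - p * m ^+ h by rewrite -pE; ring.
  have -> : residue 1%R h = 1 - q * m ^+ h by rewrite -qE; ring.
  have -> : residue (u%:~R) h = u - r * m ^+ h by rewrite -rE; ring.
  by rewrite -[X in _ - (X - _)]uv; ring.
pose y h := sval (cid (inv h)).
have yE h : padic_lvl x h * y h = 1 by apply: svalP (cid (inv h)).
have cy : compatible y.
  move=> h.
  pose z : zmod (`|m| ^ h)%N := inZp (y h.+1).
  have e : padic_lvl x h * z = 1.
    rewrite -(padic_lvlP x h).
    apply: etrans (compatible1 m h); rewrite -(yE h.+1); apply: val_inj => /=.
    by rewrite modnMm (modn_dvdm _ (dvd_lvl m h)).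
  apply: etrans (esym (mul1r z)) _; by rewrite -(yE h) mulrAC e mul1r.
by exists (Padic cy); apply: padic_eq => h; apply: yE.
Qed.

(** Projections to the discrete levels are continuous, so cylinders are neighbourhoods. Levels being
    nested, the cylinders at x generate a filter, which converges to x at every level. *)
Lemma nbhs_padicP x (U : set (padic m)) :
  nbhs x U <-> exists h, forall y, padic_lvl y h = padic_lvl x h -> U y.
Proof.
split; last first.
  move=> [h hU]; apply: (@filterS _ (nbhs x) _ _ _ hU).
  have c : continuous (fun z : padic m => set_val z).
    exact: initial_continuous.
  pose K h := discrete_topology (zmod (`|m| ^ h)%N).
  have := continuous_comp (c x) (@proj_continuous nat K h (set_val x)).
  by move=> /(_ [set padic_lvl x h]); apply; exact: (@discrete_set1 (K h)).
pose F : set_system (padic m) :=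
  [set U | exists h, forall y, padic_lvl y h = padic_lvl x h -> U y].
have lvl_le h h' y : (h <= h')%N -> padic_lvl y h' = padic_lvl x h' ->
    padic_lvl y h = padic_lvl x h.
  move=> hh' e; apply/residue_eq.
  have -> : residue y h - residue x h = (residue y h - residue y h') +
    (residue x h' - residue x h) by rewrite /residue e; ring.
  by rewrite rpredD ?residue_le // -opprB rpredN residue_le.
have FF : Filter F.
  split.
  - by exists 0%N.
  - move=> A B [h hA] [h' hB]; exists (maxn h h') => y e; split.
      by apply/hA/(lvl_le _ _ _ (leq_maxl h h')).
    by apply/hB/(lvl_le _ _ _ (leq_maxr h h')).
  - by move=> A B AB [h hA]; exists h => y /hA /AB.
suff : F --> x by apply.
apply: initial_cvg; apply/cvg_sup => h; apply: initial_cvg.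
apply/discrete_cvg; exists h => y e; exact: e.
Qed.

End PadicLevels.

(** * Neighbourhoods in the space of marked groups *)

Section MarkedTopology.
Variable R : realType.
Local Notation G2 := (marked_space R 2).
Implicit Types x y z : G2.

Lemma agree_sym k x y : agree k x y -> agree k y x.
Proof. by move=> xy w /xy ->. Qed.

Lemma agree_trans k y x z : agree k x y -> agree k y z -> agree k x z.
Proof. by move=> xy yz w wk; rewrite xy // yz. Qed.

Lemma agree_le j k x y : (j <= k)%N -> agree k x y -> agree j x y.
Proof. by move=> jk xy w wj; apply: xy; apply: leq_trans jk. Qed.

Lemma agree_eq x y : (forall k, agree k x y) -> x = y.
Proof. by move=> xy; apply: marked_space_ext => w; apply: (xy (size (word_of w))). Qed.

(** The open ball of radius e^-k consists of the groups with the same trivial words up to length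
    k. *)
Lemma nbhs_markedP x (U : set G2) :
  nbhs x U <-> exists k, forall y, agree k x y -> U y.
Proof.
split=> [/nbhs_ballP[e /= e0 eU]|[k kU]].
  have [k ke] : exists k : nat, expR (- k%:R) < e.
    exists (Num.bound e^-1); rewrite expRN invf_plt ?posrE ?expR_gt0 //.
    apply: lt_le_trans (expR_ge1Dx _).
    apply: (@lt_trans _ _ (Num.bound e^-1)%:R); last by rewrite ltrDr.
    by apply: archi_boundP; rewrite invr_ge0 ltW.
  exists k => y xy; apply: eU; rewrite /ball /= /marked_dist.
  case: eqP => [//|/[dup] xney /shortest_separatingP[ [w xyw sE] _]].
  apply: le_lt_trans ke; rewrite ler_expR lerN2 ler_nat sE leqNgt.
  by apply/negP => wk; apply/xyw/xy/ltnW.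
apply/nbhs_ballP; exists (expR (- k%:R)) => /=; first exact: expR_gt0.
move=> y; rewrite /ball /= /marked_dist => xy; apply: kU => w wk.
move: xy; case: eqP => [-> //|/shortest_separatingP[_ min]].
rewrite ltr_expR ltrN2 ltr_nat => ks; apply: contrapT => xyw.
by have := leq_trans ks (min _ (ex_intro2 _ _ w xyw erefl)); rewrite ltnNge wk.
Qed.

End MarkedTopology.

(** * Limits *)

Section LimitGroups.
Variables (R : realType) (m : int).
Hypothesis m0 : m != 0.
Implicit Types (xi eta : padic m) (w : free_group 2).

Definition eventually_trivial xi : set (free_group 2) :=
  [set w | exists N : nat, forall n : int, (N <= `|n|)%N ->
     (m ^+ N %| n - residue xi N)%Z -> class_trivial (BS R m n) w].

(** These words form a normal subgroup, so imposing them as relators makes no other word trivial. *)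
Lemma eventually_trivial_class xi :
  exists M : marked_group 2, eventually_trivial xi = trivial_in M.
Proof.
exists (presented (eventually_trivial xi)); apply/seteqP; split=> w.
  by move=> ew; apply/presented_trivial/nc_incl.
move=> /presented_trivial; elim=> {w} [//||x y _ [N xN] _ [N' yN']|x _ [N xN]|x y _ [N xN]].
- by exists 0%N => n _ _; apply/presented_trivial/nc_one.
- exists (maxn N N') => n nN nxi.
  apply/presented_trivial/nc_mul; apply/presented_trivial.
    by apply: xN (approx_le m0 _ nxi); rewrite ?leq_maxl //; lia.
  by apply: yN' (approx_le m0 _ nxi); rewrite ?leq_maxr //; lia.
- by exists N => n nN nxi; apply/presented_trivial/nc_inv/presented_trivial/xN.
- by exists N => n nN nxi; apply/presented_trivial/nc_conj/presented_trivial/xN.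
Qed.

Definition limit_class xi : marked_space R 2 :=
  MarkedClass R (eventually_trivial_class xi).

(** N comes from [BS_agree] and is uniform in xi; continuity in xi rests on this. *)
Lemma limit_agree (k : nat) : exists N : nat, forall xi (n : int),
  (N <= `|n|)%N -> (m ^+ N %| n - residue xi N)%Z ->
  agree k (BS R m n) (limit_class xi).
Proof.
have [N NP] := BS_agree R k m0; exists N => xi n nN nxi w wk.
have cong n' : (m ^+ N %| n' - residue xi N)%Z -> (m ^+ N %| n - n')%Z.
  by move=> n'xi; rewrite (_ : n - n' = (n - residue xi N) - (n' - residue xi N));
    [apply: rpredB | ring].
split=> [wn|[N' wN']].
  by exists N => n' n'N n'xi; apply/(NP n n' nN n'N (cong _ n'xi) w wk).
(* An n' close enough to xi for both N and N' links n to the eventual behaviour. *)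
have [n' [n'N n'xi]] := approx_exists m0 xi (maxn N N') (maxn N N').
apply/(NP n n' nN _ (cong _ _) w wk); first by lia.
  by apply: approx_le n'xi => //; apply: leq_maxl.
by apply: wN'; [lia | apply: approx_le n'xi => //; apply: leq_maxr].
Qed.

Lemma admissible_exists xi : exists u, admissible xi u.
Proof.
(* The bound [k.+1] keeps the terms non-zero, including the one for k = 0. *)
have ex k := cid (approx_exists m0 xi k k.+1).
exists (fun k => sval (ex k)); split.
- move=> k /=; case: (ex k) => n /= [kn _]; lia.
- apply/cvgnyPge => A; exists A => // k /= Ak.
  by case: (ex k) => n /= [kn _]; lia.
- move=> U /(nbhs_padicP m0)[h hU]; exists h => // k /= hk; apply: hU.
  by apply/lvl_int => //; have [_] := svalP (ex k); apply: approx_le.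
Qed.

(** [limit_class xi] is a limit along every admissible sequence, so [xget] does not return its
    default. An admissible sequence exists, and uniqueness of its limit identifies the chosen
    value. *)
Lemma BSbarE xi : BSbar R xi = limit_class xi.
Proof.
have adm u N : admissible xi u -> \forall k \near \oo,
    (N <= `|u k|)%N /\ (m ^+ N %| u k - residue xi N)%Z.
  move=> [_ /cvgnyPge uoo uxi]; apply: filterI; first exact: uoo.
  have xiN : nbhs xi [set y | padic_lvl y N = padic_lvl xi N].
    by apply/(nbhs_padicP m0); exists N.
  have lvlN : \forall k \near \oo,
      padic_lvl ((u k)%:~R : padic m) N = padic_lvl xi N by apply: uxi xiN.
  by apply: filterS lvlN => k e; apply/lvl_int.
have lim u : admissible xi u -> BS R m (u n) @[n --> \oo] --> limit_class xi.
  move=> uadm U /nbhs_markedP[k kU]; have [N NP] := limit_agree k.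
  apply: filterS (adm u N uadm) => n [nN nxi]; apply: kU.
  by apply/agree_sym/NP.
rewrite /BSbar; case: xgetP => [x _ xP|]; last by move=> /(_ (limit_class xi)) [].
have [u uadm] := admissible_exists xi.
apply: agree_eq => k.
have near_x : \forall n \near \oo, agree k x (BS R m (u n)).
  by apply: (xP u uadm); apply/nbhs_markedP; exists k.
have near_l : \forall n \near \oo, agree k (limit_class xi) (BS R m (u n)).
  by apply: (lim u uadm); apply/nbhs_markedP; exists k.
have [n [xn ln]] := filter_ex (filterI near_x near_l).
by apply: agree_trans xn _; apply: agree_sym.
Qed.

Lemma limit_class_continuous k : exists N : nat, forall xi eta,
  padic_lvl eta N = padic_lvl xi N -> agree k (limit_class xi) (limit_class eta).
Proof.
have [N NP] := limit_agree k; exists N => xi eta e.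
have [n [nN nxi]] := approx_exists m0 xi N N.
apply: (agree_trans (agree_sym (NP xi n nN nxi))); apply: NP => //.
by rewrite /residue e.
Qed.

(** A uniform form of injectivity, which also yields continuity of the inverse map. *)
Lemma limit_class_separation h : exists k : nat, forall xi eta,
  padic_units m xi -> padic_units m eta ->
  agree k (limit_class xi) (limit_class eta) -> padic_lvl eta h = padic_lvl xi h.
Proof.
have [k kP] := BS_agree_congr m0 R h; exists k => xi eta xiU etaU xieta.
(* M exceeds N and h, is a positive level as coprimality requires, and forces |n| > 1. *)
have [N NP] := limit_agree k; pose M := (N + h).+2.
have [n [nM nxi]] := approx_exists m0 xi M M.
have [n' [n'M n'eta]] := approx_exists m0 eta M M.
have le_approx j (zeta : padic m) (i : int) : (j <= M)%N -> (m ^+ M %| i - residue zeta M)%Z ->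
  (m ^+ j %| i - residue zeta j)%Z by move=> jM; apply: (approx_le m0 jM).
have nn' : (m ^+ h %| n - n')%Z.
  apply: kP; [exact: unit_coprime xiU _ nxi | lia | lia |].
  have nA : agree k (BS R m n) (limit_class xi).
    by apply: NP; [lia | apply: le_approx nxi; rewrite /M; lia].
  have n'A : agree k (BS R m n') (limit_class eta).
    by apply: NP; [lia | apply: le_approx n'eta; rewrite /M; lia].
  by apply: agree_trans nA _; apply: agree_trans xieta _; apply: agree_sym.
apply/residue_eq => //.
have -> : residue eta h - residue xi h =
  (n - residue xi h) - (n' - residue eta h) - (n - n') by ring.
rewrite rpredB // rpredB //.
  by apply: le_approx nxi; rewrite /M; lia.
by apply: le_approx n'eta; rewrite /M; lia.
Qed.

Lemma limit_class_inj xi eta : padic_units m xi -> padic_units m eta ->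
  limit_class xi = limit_class eta -> xi = eta.
Proof.
move=> xiU etaU e; apply: padic_eq => h; have [k kP] := limit_class_separation h.
by apply: kP => //; rewrite e.
Qed.

Lemma limit_point_of_unit xi : padic_units m xi ->
  limit_point (BS_coprime R m) (limit_class xi).
Proof.
move=> xiU U /nbhs_markedP[k kU]; have [N NP] := limit_agree k.
have mk B : exists n : int, [/\ n != 0, (B <= `|n|)%N, BS_coprime R m (BS R m n) &
    U (BS R m n)].
  have [n [nB nxi]] := approx_exists m0 xi N.+1 (B + N).+1.
  exists n; split; [lia | lia | |].
    by exists n => //; split; [lia | exact: unit_coprime xiU _ nxi].
  apply/kU/agree_sym/NP; first by lia.
  by apply: approx_le nxi => //.
(* Two approximations with |n'| > |n| give distinct groups, so one of them differs from the
   limit. *)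
have [n [n0 _ nX nU]] := mk 0%N; have [n' [n'0 n'n n'X n'U]] := mk (`|n|.+1)%N.
have [e|ne] := eqVneq (BS R m n) (limit_class xi); last by exists (BS R m n).
exists (BS R m n'); split=> //; rewrite -e; apply/eqP => e'.
have := BS_inj m0 n'0 n0 e'; lia.
Qed.

End LimitGroups.

(** * The boundary *)

Section Boundary.
Variables (R : realType) (m : int).
Hypothesis m0 : m != 0.

(** Only finitely many n satisfy |n| < B, so a small neighbourhood of x avoids those groups unless
    they equal x. Hence accumulation needs |n| unbounded. *)
Lemma disagree_bounded (x : marked_space R 2) (B : nat) :
  exists k : nat, forall n : int, (`|n| < B)%N ->
    agree k x (BS R m n) -> BS R m n = x.
Proof.
have one n : exists k, agree k x (BS R m n) -> BS R m n = x.
  have [e|ne] := pselect (BS R m n = x); first by exists 0%N.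
  have [k kP] : exists k, ~ agree k x (BS R m n).
    by apply/existsNP => h; apply: ne; apply/esym/agree_eq.
  by exists k => /kP.
elim: B => [|B [k kP]]; first by exists 0%N.
have [k1 k1P] := one B%:Z; have [k2 k2P] := one (- B%:Z).
exists (maxn k (maxn k1 k2)) => n; rewrite ltnS leq_eqVlt => /predU1P[nB|nB] h.
  have [e|e] : n = B%:Z \/ n = - B%:Z by lia.
    by rewrite e in h *; apply/k1P; apply: agree_le h; lia.
  by rewrite e in h *; apply/k2P; apply: agree_le h; lia.
by apply: kP nB _; apply: agree_le h; apply: leq_maxl.
Qed.

Lemma limit_point_approx (x : marked_space R 2) (N : nat) :
  limit_point (BS_coprime R m) x ->
  exists n : int, [/\ coprimez n m, (N <= `|n|)%N & agree N x (BS R m n)].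
Proof.
move=> xl; have [k kP] := disagree_bounded x N.
have [|y [/eqP yx [n [n0 nm] yE] xy]] := xl [set y | agree (maxn N k) x y].
  by apply/nbhs_markedP; exists (maxn N k).
rewrite /= -yE in xy yx; exists n; split=> //; last first.
  by apply: agree_le xy; apply: leq_maxl.
rewrite leqNgt; apply/negP => nN; apply/yx/kP => //.
by apply: agree_le xy; apply: leq_maxr.
Qed.

Lemma limit_point_unit (x : marked_space R 2) :
  limit_point (BS_coprime R m) x ->
  exists2 xi, padic_units m xi & limit_class R m0 xi = x.
Proof.
move=> xl; have /choice[u uP] := fun N => limit_point_approx N xl.
have /choice[k kP] := BS_agree_congr m0 R.
(* Past the index [k h + 2], terms agree up to length [k h] and satisfy |u N| > 1, so the ladder
   tests apply. *)
have u_congr h N N' : (k h + 2 <= N)%N -> (k h + 2 <= N')%N ->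
    (m ^+ h %| u N - u N')%Z.
  move=> hN hN'; have [cN uN xN] := uP N; have [cN' uN' xN'] := uP N'.
  apply: kP => //; [lia | lia |].
  apply: (@agree_trans _ _ x); last by apply: agree_le xN'; lia.
  by apply/agree_sym; apply: agree_le xN; lia.
pose v h := u (k h + 2)%N.
have vv h : (m ^+ h %| v h.+1 - v h)%Z.
  pose N := (k h + k h.+1 + 2)%N.
  have -> : v h.+1 - v h = (v h.+1 - u N) + (u N - v h) by ring.
  apply: rpredD; last by apply: u_congr; rewrite /N; lia.
  apply: (@dvdz_trans (m ^+ h.+1)); first exact: dvdz_exp2l.
  by apply: u_congr; rewrite /N; lia.
have cxi : compatible (fun h => padic_lvl ((v h)%:~R : padic m) h).
  move=> h; rewrite (padic_lvlP ((v h.+1)%:~R : padic m)).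
  apply/(lvl_int m0).
  have -> : v h.+1 - residue ((v h)%:~R : padic m) h =
    (v h.+1 - v h) + (v h - residue ((v h)%:~R : padic m) h) by ring.
  by apply: rpredD => //; apply: residue_int.
pose xi := Padic cxi.
have vxi h : (m ^+ h %| v h - residue xi h)%Z by apply/(lvl_int m0).
exists xi.
  apply: coprime_unit => // -[|h]; first by rewrite expr0 /coprimez gcdz1.
  apply: coprimezXr.
  rewrite -(coprimez_congr (n := v h.+1)); first by have [] := uP (k h.+1 + 2)%N.
  apply: dvdz_trans (vxi h.+1); by rewrite -[X in (X %| _)%Z]expr1 dvdz_exp2l.
apply: agree_eq => j; have [N NP] := limit_agree R m0 j.
(* M is at least j for the agreement with x, N for the size of [u M], and [k N + 2] for its
   congruence with [v N] modulo m^N. *)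
pose M := (j + N + k N + 2)%N; have [_ uM xM] := uP M.
apply/agree_sym; apply: (@agree_trans _ _ (BS R m (u M))).
  by apply: agree_le xM; rewrite /M; lia.
apply: NP; first by move: uM; rewrite /M; lia.
have -> : u M - residue xi N = (u M - v N) + (v N - residue xi N) by ring.
by apply: rpredD => //; apply: u_congr; rewrite /M; lia.
Qed.

Lemma limit_point_BS_coprime : limit_point (BS_coprime R m) = BSbar_units R m.
Proof.
apply/seteqP; split=> [x /limit_point_unit[xi xiU <-]|_ [xi xiU <-]].
  by exists xi; rewrite ?(BSbarE R m0).
by rewrite (BSbarE R m0); apply: limit_point_of_unit.
Qed.

(** The map g sends xi to its limit group and f is a chosen inverse; [limit_class_separation] makes
    f continuous and [limit_class_continuous] makes g continuous. *)
Lemma homeomorphic_BSbar_units :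
  homeomorphic (set_type (BSbar_units R m)) (set_type (padic_units m)).
Proof.
have gP (xi : set_type (padic_units m)) : BSbar_units R m (limit_class R m0 (val xi)).
  by exists (val xi); [exact: set_mem (valP xi) | rewrite (BSbarE R m0)].
pose g xi : set_type (BSbar_units R m) := SigSub (mem_set (gP xi)).
have fex (x : set_type (BSbar_units R m)) :
    exists xi : set_type (padic_units m), limit_class R m0 (val xi) = val x.
  have [xi xiU <-] := set_mem (valP x).
  by exists (SigSub (mem_set xiU)); rewrite (BSbarE R m0).
have /choice[f fP] := fex.
have unitP (xi : set_type (padic_units m)) : padic_units m (val xi).
  exact: set_mem (valP xi).
exists f, g; split.
- by move=> x; apply: val_inj; rewrite /= fP.
- move=> xi; apply: val_inj; apply: (limit_class_inj (R := R) (m0 := m0)) => //.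
- move=> x; apply: initial_cvg; first by apply: fmap_filter; apply: nbhs_filter.
  move=> U /(nbhs_padicP m0)[h hU].
  have [k kP] := limit_class_separation R m0 h.
  have nx : nbhs (val x) [set y | agree k (val x) y] by apply/nbhs_markedP; exists k.
  have := @initial_continuous _ _ (set_val : set_type (BSbar_units R m) -> _) x _ nx.
  apply: (@filterS _ _ (nbhs_filter x)) => y xy; apply: hU.
  by apply: (kP _ _ (unitP (f x)) (unitP (f y))); rewrite !fP.
- move=> xi; apply: initial_cvg; first by apply: fmap_filter; apply: nbhs_filter.
  move=> U /nbhs_markedP[k kU].
  have [N NP] := limit_class_continuous R m0 k.
  have nx : nbhs (val xi) [set y | padic_lvl y N = padic_lvl (val xi) N].
    by apply/(nbhs_padicP m0); exists N.
  have := @initial_continuous _ _ (set_val : set_type (padic_units m) -> _) xi _ nx.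
  by apply: (@filterS _ _ (nbhs_filter xi)) => y xy; apply: kU; apply: NP.
Qed.

End Boundary.

Theorem corollary2p13 (R : realType) (m : int) (hm : m != 0) :
  limit_point (BS_coprime R m) = BSbar_units R m /\
  homeomorphic (set_type (BSbar_units R m)) (set_type (padic_units m)).
Proof.
by split; [exact: limit_point_BS_coprime | exact: homeomorphic_BSbar_units].
Qed.
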